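(* Let $K$ be a number field, let $X$ be a geometrically irreducible affine variety of dimension $d\geq 1$ over $K$, and let $f:X\to X$ be a dominant endomorphism defined over $K$. Fix an embedding $X\subseteq \mathbb A^N_K$, with coordinates $(x_1,\dots,x_N)$ on $\mathbb A^N$. Let $P\subseteq X(\overline{K})$ be a subset satisfying the following three conditions: (DCI) $P$ is Zariski-dense in $X$, and there is an integer $M\geq 1$ such that for every $y\in P$ and every $1\leq i\leq N$ we have $M\cdot x_i(y)\in\mathcal O_{K^c}$, where $\mathcal O_{K^c}$ is the ring of algebraic integers of $K^c$; (BH) there is a constant $c>0$ such that $C(y):=\max\{C(y_i):1\leq i\leq N\}\leq c$ for every $y=(y_1,\dots,y_N)\in P$; (AI) the set $P\setminus f^{-1}(P)$ is not Zariski-dense in $X$. Then $(X,f)$ is of monomial type.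
   Context: Fix an algebraic closure $\overline{\mathbb Q}\subset\mathbb C$ of $\mathbb Q$; number fields are regarded as subfields of $\overline{\mathbb Q}$. For $\alpha\in\overline{\mathbb Q}$, its house is $C(\alpha)=\max\{|\sigma(\alpha)|:\sigma:\mathbb Q(\alpha)\hookrightarrow\mathbb C\}$. For a number field $K$, its maximal cyclotomic extension is $K^c=K(U(\mathbb C))$, the subfield of $\mathbb C$ generated over $K$ by the group $U(\mathbb C)$ of all roots of unity. Definition: let $X$ be a quasi-projective variety of dimension $d$ and $f:X\dashrightarrow X$ a dominant rational self-map, both over a field $k$ of characteristic zero. $(X,f)$ is of monomial type if there exist integers $l\geq1$, $n\geq d$, a group endomorphism $g:\mathbb G_{m,\overline k}^n\to\mathbb G_{m,\overline k}^n$ over $\overline k$ and a dominant morphism $\phi:\mathbb G_{m,\overline k}^n\to X_{\overline k}$ over $\overline k$ such that $f_{\overline k}^{\circ l}\circ\phi=\phi\circ g$, where $f_{\overline k}$ is the base change of $f$ to $\overline k$. *)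

(* Defs.v *)
(* algC is our model of Qbar (with its fixed complex absolute value). *)
From HB Require Import structures.
From mathcomp Require Import all_boot all_order all_algebra all_field.
From mathcomp Require Import mpoly.
Set Implicit Arguments. Unset Strict Implicit. Unset Printing Implicit Defensive.
Import Order.TTheory GRing.Theory Num.Theory.
Local Open Scope ring_scope.

Definition point (N : nat) := 'I_N -> algC.

(* The number field K = Q(theta) (primitive element), as a subfield of algC. *)
Definition inK (theta x : algC) : Prop :=
  exists p : {poly rat}, x = (map_poly ratr p).[theta].

(* K^c = K(all roots of unity): union of the fields K(z), z a root of unity
   (since z is algebraic, K(z) = K[z]). *)
Definition inKc (theta x : algC) : Prop :=
  exists (n : nat) (z : algC), (0 < n)%N /\ z ^+ n = 1 /\
    exists p : {poly algC}, (forall i, inK theta p`_i) /\ x = p.[z].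

Definition inOKc (theta x : algC) : Prop := inKc theta x /\ x \in Aint.

Definition coef_in_K (theta : algC) (N : nat) (p : {mpoly algC[N]}) : Prop :=
  forall m, inK theta p@_m.

Definition onX (N : nat) (I : seq {mpoly algC[N]}) (x : point N) : Prop :=
  forall p, p \in I -> p.@[x] = 0.

Definition vanishes_on_X (N : nat) (I : seq {mpoly algC[N]}) (q : {mpoly algC[N]}) :=
  forall x, onX I x -> q.@[x] = 0.

Definition zdense (N : nat) (I : seq {mpoly algC[N]}) (S : point N -> Prop) : Prop :=
  forall q : {mpoly algC[N]}, (forall x, S x -> q.@[x] = 0) -> vanishes_on_X I q.

Definition geom_irred (N : nat) (I : seq {mpoly algC[N]}) : Prop :=
  (exists x, onX I x) /\
  forall p q : {mpoly algC[N]}, vanishes_on_X I (p * q) ->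
    vanishes_on_X I p \/ vanishes_on_X I q.

Definition alg_indep (N : nat) (I : seq {mpoly algC[N]}) (S : {set 'I_N}) : Prop :=
  forall q : {mpoly algC[N]},
    (forall m, m \in msupp q -> forall i, i \notin S -> m i = 0%N) ->
    vanishes_on_X I q -> q = 0.

(* dim X = d : transcendence degree of the function field, i.e. the maximal
   number of algebraically independent coordinate functions. *)
Definition vdim (N : nat) (I : seq {mpoly algC[N]}) (d : nat) : Prop :=
  (exists S : {set 'I_N}, #|S| = d /\ alg_indep I S) /\
  (forall S : {set 'I_N}, alg_indep I S -> (#|S| <= d)%N).

Definition poly_map (N : nat) (F : 'I_N -> {mpoly algC[N]}) (x : point N) : point N :=
  fun k => (F k).@[x].

Definition maps_into (N : nat) (I : seq {mpoly algC[N]}) (F : 'I_N -> {mpoly algC[N]}) :=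
  forall x, onX I x -> onX I (poly_map F x).

Definition dominant_endo (N : nat) (I : seq {mpoly algC[N]}) (F : 'I_N -> {mpoly algC[N]}) :=
  zdense I (fun y => exists x, onX I x /\ y = poly_map F x).

(* G_m^n(Qbar) points, and Laurent-polynomial evaluation via (t, t^-1). *)
Definition in_torus (n : nat) (t : 'I_n -> algC) : Prop := forall i, t i != 0.

Definition tt_inv (n : nat) (t : 'I_n -> algC) : 'I_(n + n) -> algC :=
  fun i => match split i with inl j => t j | inr j => (t j)^-1 end.

Definition gm_endo (n : nat) (A : 'M[int]_n) (t : 'I_n -> algC) : 'I_n -> algC :=
  fun i => \prod_(j < n) (t j) ^ (A i j).

Definition monomial_type (N : nat) (I : seq {mpoly algC[N]}) (d : nat)
    (F : 'I_N -> {mpoly algC[N]}) : Prop :=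
  exists (l n : nat) (A : 'M[int]_n) (Phi : 'I_N -> {mpoly algC[n + n]}),
    [/\ (1 <= l)%N, (d <= n)%N,
      (forall t, in_torus t -> onX I (fun k => (Phi k).@[tt_inv t])),
      zdense I (fun y => exists t, in_torus t /\ y = (fun k => (Phi k).@[tt_inv t]))
    & (forall t, in_torus t -> forall k,
         iter l (poly_map F) (fun k' => (Phi k').@[tt_inv t]) k
         = (Phi k).@[tt_inv (gm_endo A t)])].

(* Main.v *)
(** Loxton's theorem: an algebraic integer of K^c all of whose conjugates are
    bounded by c is a sum of at most B terms e * rho, with rho a root of unity
    and e in a finite set E, where B and E depend only on K and c.  Hence P is
    covered by the images of torsion points under finitely many linear maps from
    a torus.  A set of torsion points is covered by finitely many torsion cosets
    in which it is dense, so X is dominated by finitely many maps psi_j from tori,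
    each sending a dense set of torsion points into P.

    Applying f to psi_j (xi) again gives a point of P, hence some psi_j' (xi');
    this is a vanishing sum of roots of unity with fixed coefficients.  If the
    representation psi_j' (xi') has no vanishing subsum, each of its terms must be
    proportional, with finitely many possible ratios, to a monomial in xi.  So
    f o psi_j = psi_j' o g with g a monomial map up to a torsion translation.  As
    there are finitely many j, iterating gives f^l o psi_j = psi_j o g, and a
    periodic point of g on a finite torsion group absorbs the translation.

    Loxton's theorem is proved by descent on the mean of |sigma x|^2 (after
    Cassels): writing x in Z[mu_(pm)] as a sum of al_i * y^i with al_i in Z[mu_m],
    either few al_i are nonzero and their means drop, or the level drops. *)

Require Import Defs.
From HB Require Import structures.
From mathcomp Require Import all_boot all_order all_algebra all_field.
From mathcomp Require Import mpoly ring zify.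
From Stdlib Require Import Classical FunctionalExtensionality.
Set Implicit Arguments. Unset Strict Implicit. Unset Printing Implicit Defensive.
Import Order.TTheory GRing.Theory Num.Theory.
Local Open Scope ring_scope.

(** * Conjugates *)

(** Terms inside a vanishing subsum of [psi_j' (xi')] are unconstrained. So P is sorted by
    coefficient vector, and the closures taken are those of the sets of torsion points whose image
    lies in P and whose representation is reduced; both properties then hold on a dense set of each
    coset. (AI) enters through a single polynomial, not zero on X, that vanishes at the points of P
    which f takes out of P. Some cosets have a non-dense image in X; as f is dominant, a generic
    point of a coset with dense image is sent outside these images, and the pigeonhole runs among
    cosets with dense image.

    In the descent the mean is counted in half units: at a prime not dividing m the coefficients are
    determined only up to a common shift, which may cost half a unit, while a second nonzero
    coefficient saves a whole one. *)

Lemma minCpoly_splits (x : algC) :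
  exists rs : seq algC, minCpoly x = \prod_(r <- rs) ('X - r%:P).
Proof.
have [rs Dp] := closed_field_poly_normal (minCpoly x).
by exists rs; rewrite Dp (monicP (minCpoly_monic x)) scale1r.
Qed.

(** Galois groups need a finite normal extension of Q, which [algC] is not; this one is generated by
    the roots of both minimal polynomials and comes with an embedding. *)
Lemma splitting_num_field_exists (x y : algC) :
  exists (L : splittingFieldType rat) (LC : {rmorphism L -> algC}) (a b : L),
    LC a = x /\ LC b = y.
Proof.
have [rx Drx] := minCpoly_splits x; have [ry Dry] := minCpoly_splits y.
have [L [LC [s Ds genL]]] := num_field_exists (rx ++ ry).
have [px [Dpx _] _] := minCpolyP x; have [py [Dpy _] _] := minCpolyP y.
have LCQ (q : {poly rat}) : map_poly LC (map_poly (in_alg L) q) = map_poly ratr q.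
  by rewrite -map_poly_comp; apply: eq_map_poly => a /=; rewrite alg_num_field fmorph_rat.
have axL : splitting_field_axiom L.
  exists (map_poly (in_alg L) (px * py)).
    by apply/polyOver1P; exists (px * py).
  exists s => //.
  suff -> : map_poly (in_alg L) (px * py) = \prod_(z <- s) ('X - z%:P) by exact: eqpxx.
  apply: (map_inj_poly (fmorph_inj LC) (rmorph0 LC)).
  rewrite LCQ rmorphM /= -Dpx -Dpy Drx Dry -big_cat /= -Ds big_map rmorph_prod /=.
  by apply: eq_bigr => z _; rewrite map_polyXsubC.
pose L' : splittingFieldType rat :=
  HB.pack (FieldExt.sort L) (FieldExt_isSplittingField.Build rat L axL).
exists L', LC.
have : x \in rx ++ ry.
  by rewrite mem_cat -root_prod_XsubC -Drx root_minCpoly.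
rewrite -Ds => /mapP [a _ ->].
have : y \in rx ++ ry.
  by rewrite mem_cat orbC -root_prod_XsubC -Dry root_minCpoly.
rewrite -Ds => /mapP [b _ ->].
by exists a, b.
Qed.

(** Galois theory over Q(z), carried to [algC]: the conjugates of theta form one Galois orbit,
    Galois elements extend to [algC], and polynomials in theta reduce modulo its minimal polynomial.
    Used with z = 1 for rationality and with z a root of unity in [loxton_Kc]. *)
Lemma relative_conjugates (z theta : algC) :
  exists rs : seq algC, [/\ uniq rs, {subset rs <= root (minCpoly theta)},
    forall r, r \in rs -> exists nu : {rmorphism algC -> algC}, nu z = z /\ nu theta = r
  & forall p : {poly algC}, (forall i, inK z p`_i) ->
     exists q : {poly algC}, [/\ forall i, inK z q`_i, (size q <= size rs)%N
        & p.[theta] = q.[theta]]].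
Proof.
have [L [LC [a [b [Da Db]]]]] := splitting_num_field_exists z theta.
pose F := <<1; a>>%AS.
have [rs Drs] : exists rs, minPoly F b = \prod_(r <- rs) ('X - r%:P).
  by have [rs /eqP ->] := splitting_field_normal F b; exists rs.
have LCQ (q : {poly rat}) : map_poly LC (map_poly (in_alg L) q) = map_poly ratr q.
  by rewrite -map_poly_comp; apply: eq_map_poly => c /=; rewrite alg_num_field fmorph_rat.
have FE v : v \in F -> inK z (LC v).
  case/Fadjoin_polyP => p /polyOver1P [q ->] ->; exists q.
  by rewrite -horner_map Da LCQ.
have EF x : inK z x -> exists2 v, v \in F & LC v = x.
  case=> q ->; exists (map_poly (in_alg L) q).[a].
    by apply: mempx_Fadjoin; apply/polyOver1P; exists q.
  by rewrite -horner_map Da LCQ.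
have nu_of g : g \in 'Gal({:L} / F)%g ->
    exists nu : {rmorphism algC -> algC}, forall v, nu (LC v) = LC (g v).
  move=> gG; have [nu Dnu] := extend_algC_subfield_aut LC g.
  by exists nu => v; rewrite Dnu.
have gal_ex r : r \in rs -> exists2 g, g \in 'Gal({:L} / F)%g & g b = r.
  move=> rrs; apply: normalField_root_minPoly; rewrite ?subvf ?memvf ?normalFieldf //.
  by rewrite Drs root_prod_XsubC.
have szrs : size rs = adjoin_degree F b.
  by have := size_minPoly F b; rewrite Drs size_prod_XsubC => -[].
exists (map LC rs); split.
- rewrite map_inj_uniq; last exact: fmorph_inj.
  rewrite -separable_prod_XsubC -Drs.
  by apply: (pcharf0_separable F _ b) => q; rewrite -(fmorph_pchar LC) pchar_num.
- move=> _ /mapP [r /gal_ex [g gG <-] ->]; have [nu Dnu] := nu_of g gG.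
  rewrite -Dnu Db.
  by rewrite -(minCpoly_aut nu theta); apply: root_minCpoly.
- move=> _ /mapP [r /gal_ex [g gG <-] ->]; have [nu Dnu] := nu_of g gG.
  exists nu; rewrite -Da -Db !Dnu; split=> //; congr (LC _).
  by apply: (fixed_gal _ gG); rewrite ?subvf ?memv_adjoin.
- move=> p Fp.
  have [P PF DP] : exists2 P : {poly L}, P \is a polyOver F & map_poly LC P = p.
    have /fin_all_exists [v Hv] (i : 'I_(size p)) :
        exists v, (v \in F) /\ LC v = p`_i.
      by have [v] := EF _ (Fp i); exists v.
    exists (\poly_(i < size p) (if insub i is Some j then v j else 0)).
      apply/polyOverP => i; rewrite coef_poly; case: ltnP => ip; last exact: mem0v.
      by rewrite insubT; case: (Hv (Ordinal ip)).
    apply/polyP => i; rewrite coef_map coef_poly; case: ltnP => ip.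
      by rewrite insubT /=; case: (Hv (Ordinal ip)) => _ ->.
    by rewrite raddf0 nth_default.
  exists (map_poly LC (Fadjoin_poly F b P.[b])); split.
  + move=> i; rewrite coef_map; apply: FE.
    by move: i; apply/polyOverP; apply: Fadjoin_polyOver.
  + by rewrite size_map_poly size_map szrs size_Fadjoin_poly.
  + rewrite -DP -Db !horner_map Fadjoin_poly_eq //.
    exact: mempx_Fadjoin.
Qed.

(** Over Q(1) = Q a fixed x has at most one conjugate, so reduction modulo its minimal polynomial
    leaves a constant. *)
Lemma aut_fixed_Crat (x : algC) :
  (forall nu : {rmorphism algC -> algC}, nu x = x) -> x \in Crat.
Proof.
move=> fx; have [rs [urs _ nurs prs]] := relative_conjugates 1 x.
have inK1 c : inK 1 c -> c \in Crat.
  by case=> q ->; rewrite -[1](rmorph1 ratr) horner_map Crat_rat.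
have szrs : (size rs <= 1)%N.
  case: rs urs nurs {prs} => [|r [|r' rs]] //= /and3P [rr' _ _] nurs.
  have [nu [_ Er]] := nurs r (mem_head _ _).
  have [|nu' [_ Er']] := nurs r'; first by rewrite !inE eqxx orbT.
  by move: rr'; rewrite inE -Er -Er' !fx eqxx.
have [|q [qK szq]] := prs 'X.
  move=> i; rewrite coefX; exists (if i == 1%N then 1 else 0).
  by case: eqP; rewrite ?rmorph0 ?rmorph1 ?hornerC.
rewrite hornerX => ->.
have /size1_polyC -> := leq_trans szq szrs.
by rewrite hornerC; apply: inK1.
Qed.

(** * Cyclotomic integers *)

(** The ring Z[mu_n] for n > 0. No basis is fixed and roots may repeat, so ring operations act
    directly on lists. *)
Definition cyc (n : nat) (x : algC) : Prop :=
  exists s : seq (int * algC),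
    all (fun t => t.2 ^+ n == 1) s /\ x = \sum_(t <- s) t.1%:~R * t.2.

Lemma cyc0 n : cyc n 0.
Proof. by exists [::]; rewrite big_nil. Qed.

Lemma cycZroot n (a : int) r : r ^+ n = 1 -> cyc n (a%:~R * r).
Proof. by move=> rn; exists [:: (a, r)]; rewrite /= rn eqxx big_seq1. Qed.

Lemma cyc_root n r : r ^+ n = 1 -> cyc n r.
Proof. by move=> /(@cycZroot n 1); rewrite mul1r. Qed.

Lemma cyc_int n (a : int) : cyc n a%:~R.
Proof. by rewrite -[X in cyc n X]mulr1; apply: cycZroot; rewrite expr1n. Qed.

Lemma cyc_nat n (a : nat) : cyc n a%:R.
Proof. exact: (cyc_int n a). Qed.

Lemma cyc1 n : cyc n 1.
Proof. exact: (cyc_nat n 1). Qed.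

Lemma cycD n x y : cyc n x -> cyc n y -> cyc n (x + y).
Proof.
move=> [s [Hs ->]] [t [Ht ->]]; exists (s ++ t).
by rewrite all_cat Hs Ht big_cat.
Qed.

Lemma cyc_sum n (I : Type) (r : seq I) (Q : pred I) (f : I -> algC) :
  (forall i, Q i -> cyc n (f i)) -> cyc n (\sum_(i <- r | Q i) f i).
Proof.
by move=> H; apply: big_ind => //; [apply: cyc0 | apply: cycD].
Qed.

Lemma cyc_sum_seq n (I : eqType) (r : seq I) (f : I -> algC) :
  (forall i, i \in r -> cyc n (f i)) -> cyc n (\sum_(i <- r) f i).
Proof. by move=> H; rewrite big_seq; apply: cyc_sum. Qed.

Lemma cycM n x y : cyc n x -> cyc n y -> cyc n (x * y).
Proof.
move=> [s [Hs ->]] [t [Ht ->]]; rewrite mulr_suml.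
apply: cyc_sum_seq => u us; rewrite mulr_sumr; apply: cyc_sum_seq => v vt.
rewrite mulrACA -intrM; apply: cycZroot.
by rewrite exprMn (eqP (allP Hs _ us)) (eqP (allP Ht _ vt)) mulr1.
Qed.

Lemma cycN n x : cyc n x -> cyc n (- x).
Proof. by rewrite -mulN1r; apply: cycM; apply: (cyc_int n (-1)). Qed.

Lemma cycB n x y : cyc n x -> cyc n y -> cyc n (x - y).
Proof. by move=> cx /cycN; apply: cycD. Qed.

Lemma cyc_prod n (I : Type) (r : seq I) (Q : pred I) (f : I -> algC) :
  (forall i, Q i -> cyc n (f i)) -> cyc n (\prod_(i <- r | Q i) f i).
Proof.
by move=> H; apply: big_ind => //; [apply: cyc1 | apply: cycM].
Qed.

Lemma cycX n x k : cyc n x -> cyc n (x ^+ k).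
Proof.
by move=> cx; elim: k => [|k IH]; rewrite ?expr0 ?exprS; [apply: cyc1 | apply: cycM].
Qed.

Lemma cyc_dvd m n x : (m %| n)%N -> cyc m x -> cyc n x.
Proof.
move=> /dvdnP [d ->] [s [Hs ->]]; exists s; split=> //.
by apply: sub_all Hs => t /eqP; rewrite mulnC exprM => ->; rewrite expr1n.
Qed.

Lemma cyc_Aint n x : (0 < n)%N -> cyc n x -> x \in Aint.
Proof.
move=> n0 [s [Hs ->]]; rewrite big_seq rpred_sum // => t ts.
rewrite rpredM ?Aint_int //; apply: (Aint_unity_root n0).
by apply/unity_rootP; apply/eqP; apply: (allP Hs).
Qed.

Lemma cyc_aut n (nu : {rmorphism algC -> algC}) x : cyc n x -> cyc n (nu x).
Proof.
move=> [s [Hs ->]]; rewrite rmorph_sum; apply: cyc_sum_seq => t ts.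
rewrite rmorphM rmorph_int; apply: cycZroot.
by rewrite -rmorphXn (eqP (allP Hs _ ts)) rmorph1.
Qed.

(** Only the action on n-th roots of unity is prescribed; elsewhere the extension is arbitrary, and
    the identity is a dummy value for k not coprime to n. *)
Definition tau (n k : nat) : {rmorphism algC -> algC} :=
  if @idP (coprime k n) is ReflectT H then sval (Qn_aut_exists H) else idfun.

Lemma tauE n k z : coprime k n -> z ^+ n = 1 -> tau n k z = z ^+ k.
Proof.
move=> ckn zn; rewrite /tau; case: {-}_ / idP => // H.
by case: (Qn_aut_exists H) => u /= ->.
Qed.

Lemma aut_cyc_eq n (nu mu : {rmorphism algC -> algC}) x :
  (forall z, z ^+ n = 1 -> nu z = mu z) -> cyc n x -> nu x = mu x.
Proof.
move=> H [s [Hs ->]]; rewrite !rmorph_sum; apply: eq_big_seq => t ts.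
by rewrite !rmorphM !rmorph_int H // (eqP (allP Hs _ ts)).
Qed.

Definition inQcyc n x := exists2 d : nat, (0 < d)%N & cyc n (d%:R * x).

Lemma cyc_inQcyc n x : cyc n x -> inQcyc n x.
Proof. by exists 1%N => //; rewrite mul1r. Qed.

Lemma aut_inQcyc_eq n (nu mu : {rmorphism algC -> algC}) x :
  (forall z, z ^+ n = 1 -> nu z = mu z) -> inQcyc n x -> nu x = mu x.
Proof.
move=> H [d d0 /(aut_cyc_eq H)]; rewrite !rmorphM !rmorph_nat; apply: mulfI.
by rewrite pnatr_eq0 -lt0n.
Qed.

Lemma aut_pow n (nu : {rmorphism algC -> algC}) : (0 < n)%N ->
  exists2 k, coprime k n & forall z, z ^+ n = 1 -> nu z = z ^+ k.
Proof.
move=> n0; have [w pw] := C_prim_root_exists n0.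
have pnw : n.-primitive_root (nu w) by rewrite fmorph_primitive_root.
have [k Dk] := prim_rootP pw (prim_expr_order pnw); exists k.
  by rewrite -(prim_root_exp_coprime k pw) -Dk.
by move=> z /(prim_rootP pw) [i ->]; rewrite rmorphXn /= Dk exprAC.
Qed.

(** On mu_n, nu is a power map with exponent e prime to n, so composing with [tau n k] multiplies
    the index by e modulo n. Hence traces and norms from Q(mu_n) are invariant. *)
Lemma aut_permutes_tau n (nu : {rmorphism algC -> algC}) : (0 < n)%N ->
  exists f : 'I_n -> 'I_n, [/\ injective f, forall k, coprime (f k) n = coprime k n
    & forall (k : 'I_n) x, coprime k n -> inQcyc n x -> nu (tau n k x) = tau n (f k) x].
Proof.
move=> n0; have [e cen De] := aut_pow nu n0.
exists (fun k => Ordinal (ltn_pmod (k * e) n0)); split.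
- apply: (@can_inj _ _ _ (fun k : 'I_n => Ordinal (ltn_pmod (k * (egcdn e n).1) n0))) => k.
  apply: val_inj => /=.
  rewrite modnMml -mulnA -modnMmr -{1}(mul1n e).
  by rewrite (chinese_modr cen 0) modnMmr muln1 modn_small.
- by move=> k /=; rewrite coprime_modl coprimeMl cen andbT.
- move=> k x ckn; apply: (aut_inQcyc_eq (nu := nu \o tau n k)) => z zn /=.
  rewrite !tauE // ?coprime_modl ?coprimeMl ?ckn // rmorphXn /= De // -exprM mulnC.
  by rewrite expr_mod.
Qed.

Lemma cyc_trace_Crat n x : (0 < n)%N -> inQcyc n x ->
  \sum_(k < n | coprime k n) tau n k x \in Crat.
Proof.
move=> n0 Qx; apply: aut_fixed_Crat => nu.
have [f [finj fcop fE]] := aut_permutes_tau nu n0.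
rewrite rmorph_sum /= [RHS](reindex_inj finj) /=.
apply: eq_big => k; first by rewrite fcop.
by move=> ckn; rewrite fE.
Qed.

Lemma cyc_norm_Crat n x : (0 < n)%N -> inQcyc n x ->
  \prod_(k < n | coprime k n) tau n k x \in Crat.
Proof.
move=> n0 Qx; apply: aut_fixed_Crat => nu.
have [f [finj fcop fE]] := aut_permutes_tau nu n0.
rewrite rmorph_prod /= [RHS](reindex_inj finj) /=.
apply: eq_big => k; first by rewrite fcop.
by move=> ckn; rewrite fE.
Qed.

(** * Trace expansion, denominators and energy *)

Lemma sum_unity_powers (n : nat) (z : algC) : z ^+ n = 1 ->
  \sum_(i < n) z ^+ i = if z == 1 then n%:R else 0.
Proof.
move=> zn; case: eqP => [->|/eqP z1].
  by rewrite (eq_bigr (fun=> 1)) ?sumr_const ?card_ord // => i _; rewrite expr1n.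
apply: (mulfI (_ : z - 1 != 0)); first by rewrite subr_eq0.
by rewrite -subrX1 zn subrr mulr0.
Qed.

(** Fourier inversion: after exchanging the sums, index k carries the sum over i of the powers
    (w^(1-k))^i, which vanishes unless k = 1 modulo n. *)
Lemma cyc_trace_expansion n w x : n.-primitive_root w -> inQcyc n x ->
  n%:R * x = \sum_(i < n) (\sum_(k < n | coprime k n) tau n k (x * w ^- i)) * w ^+ i.
Proof.
move=> pw Qx; have n0 := prim_order_gt0 pw; have wn := prim_expr_order pw.
have w0 : w != 0 by apply: contraTneq (oner_neq0 algC) => w0; rewrite -wn w0 expr0n gtn_eqF // eqxx.
under eq_bigr do rewrite mulr_suml.
rewrite exchange_big /=.
(* 1 modulo n, so that n = 1, where the only index is 0, is covered. *)
pose k1 := Ordinal (ltn_pmod 1 n0).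
rewrite (bigD1 k1) /=; last by rewrite coprime_modl coprime1n.
rewrite [X in _ + X]big1 ?addr0 => [|k /andP [ckn kk1]].
  have E : tau n (1 %% n) x = x.
    apply: (aut_inQcyc_eq (mu := idfun)) Qx => z zn /=.
    by rewrite tauE ?coprime_modl ?coprime1n // expr_mod.
  under eq_bigr => i _.
    rewrite rmorphM /= E rmorphV ?unitfE ?expf_neq0 // rmorphXn /= (@tauE _ _ w) ?coprime_modl ?coprime1n //.
    rewrite expr_mod // expr1 mulfVK ?expf_neq0 //; over.
  by rewrite sumr_const card_ord mulr_natl.
under eq_bigr => i _.
  rewrite rmorphM /= rmorphV ?unitfE ?expf_neq0 // rmorphXn /= (tauE ckn wn).
  rewrite -mulrA -exprVn -exprMn; over.
rewrite -mulr_sumr sum_unity_powers; last first.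
  by rewrite exprMn wn mulr1 exprVn -exprM mulnC exprM wn expr1n invr1.
case: eqP => [E|_]; last by rewrite mulr0.
case/eqP: kk1; apply: val_inj => /=; apply/eqP.
have /eqP : w ^+ k = w ^+ 1.
  by rewrite expr1 -[LHS]mulr1 -E mulrA divff ?mul1r // expf_neq0.
by rewrite (eq_prim_root_expr pw) => /eqP <-; rewrite modn_small.
Qed.

Lemma cyc_trace_int n x : (0 < n)%N -> inQcyc n x -> x \in Aint ->
  \sum_(k < n | coprime k n) tau n k x \in Num.int.
Proof.
move=> n0 Qx Ax; apply: Cint_rat_Aint; first exact: cyc_trace_Crat.
by rewrite rpred_sum // => k _; rewrite Aint_aut.
Qed.

Lemma inQcycM n x y : inQcyc n x -> cyc n y -> inQcyc n (x * y).
Proof.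
by move=> [d d0 cx] cy; exists d => //; rewrite mulrA; apply: cycM.
Qed.

Lemma unity_rootV (n : nat) (z : algC) : z ^+ n = 1 -> z^-1 ^+ n = 1.
Proof. by move=> zn; rewrite exprVn zn invr1. Qed.

Lemma Aint_root (n : nat) (z : algC) : (0 < n)%N -> z ^+ n = 1 -> z \in Aint.
Proof. by move=> n0 zn; apply: (Aint_unity_root n0); apply/unity_rootP. Qed.

(** The coefficients in the trace expansion of n x are rational traces of algebraic integers, hence
    integers. *)
Lemma cyc_Aint_mul_order n x : (0 < n)%N -> inQcyc n x -> x \in Aint -> cyc n (n%:R * x).
Proof.
move=> n0 Qx Ax; have [w pw] := C_prim_root_exists n0; have wn := prim_expr_order pw.
rewrite (cyc_trace_expansion pw Qx); apply: cyc_sum => i _.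
have wi : (w ^- i) ^+ n = 1 by apply: unity_rootV; rewrite exprAC wn expr1n.
have Q2 : inQcyc n (x * w ^- i) by apply: inQcycM Qx (cyc_root wi).
have /intrP [a ->] := cyc_trace_int n0 Q2 (rpredM Ax (Aint_root n0 wi)).
by apply: cycZroot; rewrite exprAC wn expr1n.
Qed.

(** [totient n] times the mean of |sigma x|^2. Being unnormalized, it depends on the level n and is
    compared with multiples of [totient n]. *)
Definition energy n x : algC := \sum_(k < n | coprime k n) `|tau n k x| ^+ 2.

Lemma energy_ge0 n x : 0 <= energy n x.
Proof. by apply: sumr_ge0 => k _; rewrite exprn_ge0. Qed.

Lemma energy0 n : energy n 0 = 0.
Proof. by rewrite /energy big1 // => k _; rewrite rmorph0 normr0 expr0n. Qed.

Lemma cyc_norm_int n x : (0 < n)%N -> cyc n x -> 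
  \prod_(k < n | coprime k n) tau n k x \in Num.int.
Proof.
move=> n0 cx; apply: Cint_rat_Aint; first exact: cyc_norm_Crat (cyc_inQcyc cx).
by rewrite rpred_prod // => k _; rewrite Aint_aut (cyc_Aint n0).
Qed.

Lemma card_coprime n : #|[pred k : 'I_n | coprime k n]| = totient n.
Proof.
rewrite totient_count_coprime big_mkord -sum1_card [LHS]big_mkcond /=.
by apply: eq_bigr => k _; rewrite inE coprime_sym; case: coprime.
Qed.

(* AM-GM applied to the norm, a nonzero integer. *)
Lemma energy_ge_totient n x : (0 < n)%N -> cyc n x -> x != 0 ->
  (totient n)%:R <= energy n x.
Proof.
move=> n0 cx x0; pose A := [pred k : 'I_n | coprime k n].
have [|AGM _] := @leif_AGM_scaled algC _ A (fun k => `|tau n k x| ^+ 2).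
  by move=> k _; rewrite mulrn_wge0 // exprn_ge0.
rewrite prodrMn_const card_coprime -/(energy n x) in AGM.
have N0 : \prod_(k < n | coprime k n) tau n k x != 0.
  by apply/prodf_neq0 => k _; rewrite fmorph_eq0.
have N1 : 1 <= \prod_(k < n | coprime k n) `|tau n k x| ^+ 2.
  rewrite prodrXl -normr_prod exprn_ege1 //.
  by apply: norm_intr_ge1; rewrite // cyc_norm_int.
have tot0 : (0 < totient n)%N by rewrite totient_gt0.
rewrite -(ler_pXn2r tot0) ?nnegrE ?ler0n ?energy_ge0 //.
by apply: le_trans AGM; rewrite -natrX lerMn2r N1 orbT.
Qed.

(** * The ring of integers of a cyclotomic field *)

Lemma cyc_coprime_mul n a b x : (0 < a)%N -> coprime a b ->
  cyc n (a%:R * x) -> cyc n (b%:R * x) -> cyc n x.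
Proof.
move=> a0 cab ca cb; case: (egcdnP b a0) => u v E _.
have -> : x = u%:R * (a%:R * x) - v%:R * (b%:R * x).
  by rewrite !mulrA -!natrM E (eqP cab) natrD mulrDl mul1r [X in X - _]addrC addrK.
by apply: cycB; apply: cycM; rewrite // ; apply: cyc_nat.
Qed.

Lemma unity_root_neq0 (n : nat) (z : algC) : (0 < n)%N -> z ^+ n = 1 -> z != 0.
Proof.
by move=> n0; apply: contra_eq_neq => ->; rewrite expr0n gtn_eqF // eq_sym oner_neq0.
Qed.

Lemma unity_root_split (a b : nat) (r : algC) : (0 < a)%N -> (0 < b)%N -> coprime a b ->
  r ^+ (a * b) = 1 -> exists s t, [/\ s ^+ a = 1, t ^+ b = 1 & r = s * t].
Proof.
move=> a0 b0 cab r1; case: (egcdnP b a0) => u v E _; rewrite (eqP cab) in E.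
exists (r ^- (v * b)), (r ^+ (u * a)); split.
- by rewrite exprVn -exprM -mulnA [(b * a)%N]mulnC mulnC exprM r1 expr1n invr1.
- by rewrite -exprM -mulnA mulnC exprM r1 expr1n.
- have r0 : r != 0 by apply: unity_root_neq0 r1; rewrite muln_gt0 a0.
  by rewrite E exprD expr1 mulKf // expf_neq0.
Qed.

Section FrobeniusCongruence.
Variables (n p k : nat).
Hypotheses (pp : prime p) (cpn : coprime p n).

Lemma cyc_exp_prime_add x y : cyc n x -> cyc n y ->
  exists2 c, cyc n c & (x + y) ^+ p = x ^+ p + y ^+ p + p%:R * c.
Proof.
move=> cx cy; have [q Dp] : exists q, p = q.+1 by exists p.-1; rewrite prednK ?prime_gt0.
exists (\sum_(i < q) ('C(p, i.+1) %/ p)%:R * (x ^+ (p - i.+1) * y ^+ i.+1)).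
  by apply: cyc_sum => i _; apply: cycM (cyc_nat _ _) (cycM (cycX _ cx) (cycX _ cy)).
pose F i := x ^+ (p - i.+1) * y ^+ i.+1 *+ 'C(p, i.+1).
rewrite exprDn big_ord_recl /= subn0 expr0 mulr1 bin0 mulr1n.
have -> : \sum_(i < p) x ^+ (p - bump 0 i) * y ^+ bump 0 i *+ 'C(p, bump 0 i) =
          \sum_(i < q.+1) F i by rewrite -Dp.
rewrite big_ord_recr /= {2}/F -Dp subnn expr0 mul1r binn mulr1n [X in _ + X]addrC addrA.
congr (_ + _); rewrite mulr_sumr; apply: eq_bigr => i _.
rewrite mulrA -natrM mulnC divnK ?mulr_natl //.
by apply: prime_dvd_bin => //=; rewrite Dp ltnS.
Qed.

Lemma cyc_exp_pow_add x y : cyc n x -> cyc n y ->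
  exists2 c, cyc n c & (x + y) ^+ (p ^ k) = x ^+ (p ^ k) + y ^+ (p ^ k) + p%:R * c.
Proof.
move=> cx cy; elim: k => [|j [c cc E]].
  by exists 0; [apply: cyc0 | rewrite !expr1 mulr0 addr0].
rewrite expnSr !exprM E.
have cxj := cycX (p ^ j) cx; have cyj := cycX (p ^ j) cy.
have cpc : cyc n (p%:R * c) by apply: cycM cc; apply: cyc_nat.
have [c1 cc1 ->] := cyc_exp_prime_add (cycD cxj cyj) cpc.
have [c2 cc2 ->] := cyc_exp_prime_add cxj cyj.
exists (c2 + p%:R ^+ p.-1 * c ^+ p + c1).
  apply: cycD cc1; apply: cycD => //.
  by apply: cycM (cycX _ cc); apply: cycX; apply: cyc_nat.
have Ep : p%:R ^+ p = p%:R * p%:R ^+ p.-1 :> algC by rewrite -exprS prednK ?prime_gt0.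
by rewrite exprMn Ep !mulrDr !mulrA !addrA.
Qed.

(** Both sides are additive in b modulo p and agree on n-th roots of unity. *)
Lemma frobenius_congruence b : cyc n b ->
  exists2 c, cyc n c & b ^+ (p ^ k) = tau n (p ^ k) b + p%:R * c.
Proof.
have q0 : (0 < p ^ k)%N by rewrite expn_gt0 prime_gt0.
pose G b := cyc n b /\ exists2 c, cyc n c & b ^+ (p ^ k) = tau n (p ^ k) b + p%:R * c.
have G0 : G 0.
  split; first exact: cyc0; exists 0; first exact: cyc0.
  by rewrite rmorph0 mulr0 addr0 expr0n gtn_eqF.
have GD x y : G x -> G y -> G (x + y).
  move=> [cx [c1 cc1 E1]] [cy [c2 cc2 E2]]; split; first exact: cycD.
  have [c cc ->] := cyc_exp_pow_add cx cy; exists (c1 + c2 + c).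
    by apply: cycD cc; apply: cycD.
  by rewrite E1 E2 rmorphD; ring.
have GN x : G x -> G (- x).
  move=> [cx [c1 cc1 E1]]; split; first exact: cycN.
  (* Additivity applied to x + (-x) = 0 spares a discussion of the parity of p. *)
  have [c cc] := cyc_exp_pow_add cx (cycN cx).
  rewrite subrr expr0n (gtn_eqF q0) E1 rmorphN mulr0n => E.
  exists (- (c1 + c)); first by apply: cycN; apply: cycD.
  by apply/eqP; rewrite -subr_eq0 [X in _ == X]E; apply/eqP; ring.
have Groot r : r ^+ n = 1 -> G r.
  move=> rn; split; first exact: cyc_root.
  by exists 0; [exact: cyc0 | rewrite mulr0 addr0 tauE // coprimeXl].
move=> [s [Hs Db]]; suff [] : G b by [].
rewrite Db big_seq; apply: big_ind => // t ts.
have Gt := Groot _ (eqP (allP Hs _ ts)).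
have Gnat (a : nat) : G (a%:R * t.2).
  by elim: a => [|a IH]; rewrite ?mul0r // mulrSr mulrDl mul1r; apply: GD.
by case: (t.1) => a; rewrite ?NegzE ?rmorphN ?mulNr; [|apply: GN]; apply: Gnat.
Qed.

End FrobeniusCongruence.

(** The polynomial is (X^(p^(k+1)) - 1) / (X^(p^k) - 1), a sum of p powers of X. *)
Lemma cyclotomic_prime_power_at_1 (p k : nat) (w : algC) : prime p ->
  (p ^ k.+1).-primitive_root w -> (cyclotomic w (p ^ k.+1)).[1] = p%:R.
Proof.
move=> pp pw; set q := (p ^ k)%N.
have p0 := prime_gt0 pp; have p1 := prime_gt1 pp.
have q0 : (0 < q)%N by rewrite expn_gt0 p0.
have wp : q.-primitive_root (w ^+ p).
  by have := dvdn_prim_root pw (dvdn_exp2l p (leqnSn k)); rewrite expnSr mulKn.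
have perm : perm_eq (divisors (p ^ k.+1)) ((p ^ k.+1)%N :: divisors q).
  apply: uniq_perm; rewrite ?divisors_uniq //=.
    rewrite divisors_uniq -dvdn_divisors // andbT; apply/negP => /(dvdn_leq q0).
    by rewrite leqNgt ltn_exp2l ?leqnn.
  move=> d; rewrite inE -!dvdn_divisors ?expn_gt0 ?p0 //.
  apply/(dvdn_pfactor _ _ pp)/orP => [[m lm ->]|[/eqP ->|/(dvdn_pfactor _ _ pp) [m lm ->]]].
  - move: lm; rewrite leq_eqVlt => /orP [/eqP ->|lm]; [by left | right].
    by rewrite dvdn_exp2l.
  - by exists k.+1.
  - by exists m => //; apply: leqW.
have E : cyclotomic w (p ^ k.+1) * ('X^q - 1) = 'X^(p ^ k.+1) - 1.
  rewrite (prod_cyclotomic pw) (perm_big _ perm) big_cons divnn expn_gt0 p0 expr1.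
  congr (_ * _); rewrite (prod_cyclotomic wp); apply: eq_big_seq => d.
  rewrite -dvdn_divisors // => dq; congr cyclotomic.
  by rewrite -exprM muln_divA // expnS.
have nz : 'X^q - 1 != 0 :> {poly algC} by rewrite -size_poly_gt0 size_XnsubC.
have : cyclotomic w (p ^ k.+1) = \sum_(i < p) 'X^q ^+ i.
  by apply: (mulIf nz); rewrite E expnS mulnC exprM subrX1 mulrC.
move=> ->; rewrite horner_sum (eq_bigr (fun=> 1)) ?sumr_const ?card_ord // => i _.
by rewrite -exprM hornerXn expr1n.
Qed.

(** By the value at 1, p is the product of the 1 - w^j. Each of these is associated to 1 - w: it is
    a multiple of 1 - w by a geometric sum, and conversely because w is a power of w^j. *)
Lemma cyclotomic_uniformizer (p k : nat) (w : algC) : prime p ->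
  (p ^ k.+1).-primitive_root w ->
  exists u v, [/\ cyc (p ^ k.+1) u, cyc (p ^ k.+1) v,
    (1 - w) ^+ totient (p ^ k.+1) = p%:R * u & p%:R = (1 - w) ^+ totient (p ^ k.+1) * v].
Proof.
move=> pp pw; set n := (p ^ k.+1)%N in pw *.
have n0 := prim_order_gt0 pw; have wn := prim_expr_order pw.
have Dp : p%:R = \prod_(j < n | coprime j n) (1 - w ^+ j).
  rewrite -(cyclotomic_prime_power_at_1 pp pw) /cyclotomic horner_prod.
  by apply: eq_bigr => j _; rewrite hornerXsubC.
have Dpi : (1 - w) ^+ totient n = \prod_(j < n | coprime j n) (1 - w).
  by rewrite -card_coprime -prodr_const.
pose v := \prod_(j < n | coprime j n) \sum_(i < j) w ^+ i.
(* The Bezout coefficient [(egcdn j n).1] inverts j modulo n, so raising w^j to it gives w. *)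
pose u := \prod_(j < n | coprime j n) \sum_(i < (egcdn j n).1) (w ^+ j) ^+ i.
have cw i : cyc n (w ^+ i) by apply: cyc_root; rewrite exprAC wn expr1n.
have sub1X (x : algC) m : 1 - x ^+ m = (1 - x) * \sum_(i < m) x ^+ i.
  by rewrite -opprB subrX1 -mulNr opprB.
exists u, v; split.
- by apply: cyc_prod => j _; apply: cyc_sum => i _; rewrite -exprM.
- by apply: cyc_prod => j _; apply: cyc_sum => i _.
- rewrite Dp Dpi -big_split /=; apply: eq_bigr => j cjn.
  rewrite -sub1X -exprM; congr (1 - _).
  rewrite -(expr_mod _ wn); have := chinese_modr cjn 0 1.
  by rewrite /chinese !mul0n add0n mul1n => ->; rewrite expr_mod ?expr1.
- by rewrite Dp Dpi -big_split /=; apply: eq_bigr => j cjn.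
Qed.

Definition coef_cyc m (B : {poly algC}) := forall i, cyc m B`_i.

Lemma coef_cycM m A B : coef_cyc m A -> coef_cyc m B -> coef_cyc m (A * B).
Proof.
by move=> HA HB i; rewrite coefM; apply: cyc_sum => j _; apply: cycM.
Qed.

Lemma coef_cycC m x : cyc m x -> coef_cyc m x%:P.
Proof. by move=> cx i; rewrite coefC; case: eqP => _ //; apply: cyc0. Qed.

Section PrimeLocal.
Variables (p k m : nat) (w : algC).
Hypotheses (pp : prime p) (pw : (p ^ k.+1).-primitive_root w).
Hypotheses (m0 : (0 < m)%N) (cpm : coprime p m).
Let n := (p ^ k.+1 * m)%N.
Let wn : w ^+ n = 1.
Proof. by rewrite exprM (prim_expr_order pw) expr1n. Qed.
Let pi := 1 - w.
Let cpi : cyc n pi.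
Proof. by apply: cycB; [exact: cyc1 | exact: cyc_root]. Qed.

(** An n-th root of unity is w^j u with u in mu_m, and w = 1 - pi; thus Z[mu_n] = Z[mu_m][pi]. *)
Lemma cyc_uniformizer_expansion y : cyc n y ->
  exists2 B, coef_cyc m B & y = B.[pi].
Proof.
move=> [s [Hs ->]].
have /= H (t : int * algC) : t \in s -> exists2 B, coef_cyc m B & t.1%:~R * t.2 = B.[pi].
  move=> ts; have := eqP (allP Hs _ ts).
  move=> /unity_root_split [||| r [u [rn un ->]]] //.
  - by rewrite expn_gt0 prime_gt0.
  - by rewrite coprimeXl.
  - have [j ->] := prim_rootP pw rn.
    exists ((t.1%:~R * u)%:P * (1 - 'X) ^+ j).
      apply: coef_cycM; first by apply: coef_cycC; apply: cycZroot.
      elim: (j : nat) => [|i IH]; first by rewrite expr0 -polyC1; apply: coef_cycC; apply: cyc1.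
      rewrite exprS; apply: coef_cycM IH => l.
      by rewrite coefB coef1 coefX; apply: cycB; apply: cyc_nat.
    have Ew : (1 - 'X).[pi] = w by rewrite hornerD hornerN hornerX -polyC1 hornerC /pi; ring.
    by rewrite hornerM hornerC horner_exp Ew -mulrA [u * _]mulrC.
elim: s {Hs} H => [|t s IH] H.
  by exists 0; [move=> i; rewrite coef0; apply: cyc0 | rewrite big_nil horner0].
have [A HA EA] := H t (mem_head _ _).
have [|B HB EB] := IH; first by move=> v vs; apply: H; rewrite inE vs orbT.
exists (A + B); first by move=> i; rewrite coefD; apply: cycD.
by rewrite big_cons EA EB hornerD.
Qed.

(** The power b^(p^(k+1)) is a multiple of p, because pi^(totient (p^(k+1))) is. By the Frobenius
    congruence so is a conjugate of b, hence b / p is integral. It lies in Z[mu_m], since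
    multiplying it by m or by p, which are coprime, lands there. *)
Lemma cyc_uniformizer_dvd b o : cyc m b -> o \in Aint -> b = pi * o ->
  exists2 c, cyc m c & b = p%:R * c.
Proof.
move=> cb Ao Eb; have q0 : (0 < p ^ k.+1)%N by rewrite expn_gt0 prime_gt0.
have p0 : p%:R != 0 :> algC by rewrite pnatr_eq0 -lt0n prime_gt0.
have [u [v [cu _ Eu _]]] := cyclotomic_uniformizer pp pw.
have Api : pi \in Aint by apply: rpredB; rewrite ?rpred1 // (Aint_prim_root pw).
have le : (totient (p ^ k.+1) <= p ^ k.+1)%N.
  by rewrite totient_pfactor // expnS leq_mul2r leq_pred orbT.
have [c cc Ec] := frobenius_congruence k.+1 pp cpm cb.
suff Ab : b / p%:R \in Aint.
  exists (b / p%:R); last by rewrite mulrC divfK.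
  have Qb : cyc m (p%:R * (b / p%:R)) by rewrite mulrC divfK.
  apply: (cyc_coprime_mul _ cpm) => //; first exact: prime_gt0.
  by apply: cyc_Aint_mul_order => //; exists p; rewrite ?prime_gt0.
rewrite -(Aint_aut (tau m (p ^ k.+1))) rmorphM fmorphV rmorph_nat.
have -> : tau m (p ^ k.+1) b = b ^+ (p ^ k.+1) - p%:R * c by rewrite Ec addrK.
rewrite Eb exprMn -{1}(subnKC le) exprD Eu -!mulrA -mulrBr mulrC mulKf //.
rewrite rpredB ?rpredM ?rpredX // ?(cyc_Aint _ cu) //.
exact: cyc_Aint cc.
Qed.

(** Write y = pi A(pi) + b with b in Z[mu_m]. Then pi divides b, so p does, and p is a multiple of
    pi^(i+1) by the bound on the exponent; cancelling one factor pi leaves A(pi) divisible by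
    pi^i. *)
Lemma cyc_uniformizer_pow_dvd i y o : (i <= totient (p ^ k.+1))%N ->
  cyc n y -> o \in Aint -> y = pi ^+ i * o -> exists2 z, cyc n z & y = pi ^+ i * z.
Proof.
have q0 : (0 < p ^ k.+1)%N by rewrite expn_gt0 prime_gt0.
have n0 : (0 < n)%N by rewrite muln_gt0 q0.
have [u [v [_ cv _ Ev]]] := cyclotomic_uniformizer pp pw.
have cmn x : cyc m x -> cyc n x by apply: cyc_dvd; rewrite dvdn_mull.
have cvn : cyc n v by apply: cyc_dvd cv; rewrite dvdn_mulr.
have pi0 : pi != 0.
  apply: contraTneq (prime_gt0 pp) => Epi.
  have : p%:R = 0 :> algC by rewrite Ev -/pi Epi expr0n gtn_eqF ?mul0r // totient_gt0.
  by move=> /eqP; rewrite pnatr_eq0 => /eqP ->.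
move=> le /cyc_uniformizer_expansion [B].
elim: i le B y o => [|i IH] le B y o HB EB Ao Ey.
  exists y; last by rewrite mul1r.
  rewrite EB horner_coef; apply: cyc_sum => j _.
  by apply: cycM (cycX _ cpi); apply: cmn.
move: HB EB; elim/poly_ind: B => [|A b _] HB EB.
  by exists 0; [exact: cyc0 | rewrite EB horner0 mulr0].
have HA : coef_cyc m A by move=> j; have := HB j.+1; rewrite coefD coefMX coefC addr0.
have Hb : cyc m b by have := HB 0%N; rewrite coefD coefMX coefC add0r.
have EA : y = A.[pi] * pi + b by rewrite EB !hornerE.
have cA : cyc n A.[pi].
  rewrite horner_coef; apply: cyc_sum => j _.
  by apply: cycM (cycX _ cpi); apply: cmn.
have [||c cc Ec] := @cyc_uniformizer_dvd b (pi ^+ i * o - A.[pi]) Hb.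
- by rewrite rpredB ?rpredM ?rpredX // ?(cyc_Aint n0).
- by rewrite mulrBr mulrA -exprS -Ey EA; ring.
have Ep : p%:R = pi ^+ i.+1 * (pi ^+ (totient (p ^ k.+1) - i.+1) * v).
  by rewrite mulrA -exprD subnKC.
pose t := pi ^+ (totient (p ^ k.+1) - i.+1) * v * c.
have ct : cyc n t by apply: cycM (cmn _ cc); apply: cycM cvn; apply: cycX.
have [||z cz Ez] := IH (ltnW le) A A.[pi] (o - t) HA erefl.
- by rewrite rpredB // (cyc_Aint n0).
- apply: (mulIf pi0); rewrite -[LHS](addrK b) -EA Ey Ec Ep /t exprS; ring.
exists (z + t); first exact: cycD.
by rewrite EA Ec Ep Ez /t exprS; ring.
Qed.

Lemma cyc_prime_saturated x : x \in Aint -> cyc n (p%:R * x) -> cyc n x.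
Proof.
have q0 : (0 < p ^ k.+1)%N by rewrite expn_gt0 prime_gt0.
have [u [v [cu cv Eu Ev]]] := cyclotomic_uniformizer pp pw.
move=> Ax cpx.
have cun : cyc n u by apply: cyc_dvd cu; rewrite dvdn_mulr.
have Av : v \in Aint by apply: cyc_Aint cv.
have [|z cz Ez] := cyc_uniformizer_pow_dvd (leqnn _) cpx (rpredM Av Ax).
  by rewrite Ev mulrA.
suff -> : x = u * z by apply: cycM.
apply: (mulfI (_ : p%:R != 0)); first by rewrite pnatr_eq0 -lt0n prime_gt0.
by rewrite Ez Eu mulrA.
Qed.

End PrimeLocal.

(* Since n x is in Z[mu_n], only primes p dividing n matter.  With n = p^k m,
   expanding in powers of 1 - zeta_(p^k) reduces divisibility by p to Z[mu_m],
   where the Frobenius congruence applies because p does not divide m. *)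
Theorem Aint_inQcyc n x : (0 < n)%N -> x \in Aint -> inQcyc n x -> cyc n x.
Proof.
move=> n0 Ax [d d0]; have [m dm] := ubnP d.
elim: m d d0 x Ax dm => // m IH d d0 x Ax; rewrite ltnS => dm cdx.
have [d1|d1] := leqP d 1.
  by move: cdx; rewrite (eqP (_ : d == 1)%N) ?mul1r // eqn_leq d1.
have pp := pdiv_prime d1; set p := pdiv d in pp.
have Dd : d = (d %/ p * p)%N by rewrite divnK // pdiv_dvd.
have dp0 : (0 < d %/ p)%N by rewrite divn_gt0 ?prime_gt0 // pdiv_leq.
have cpx : cyc n (p%:R * x).
  apply: (IH (d %/ p)%N) => //.
  - by rewrite rpredM // Aint_Cnat.
  - by apply: leq_trans dm; rewrite ltn_Pdiv ?prime_gt1.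
  - by rewrite mulrA -natrM -Dd.
have [pn|npn] := boolP (p %| n)%N; last first.
  have cpn : coprime p n by rewrite prime_coprime.
  apply: (cyc_coprime_mul _ cpn) => //; first exact: prime_gt0.
  by apply: cyc_Aint_mul_order => //; exists p => //; apply: prime_gt0.
have [l cpl Dn] := pfactor_coprime pp n0.
have k0 : (0 < logn p n)%N by rewrite logn_gt0 mem_primes pp n0.
rewrite -(prednK k0) mulnC in Dn.
have [w pw] : {w : algC | (p ^ (logn p n).-1.+1).-primitive_root w}.
  by apply: C_prim_root_exists; rewrite expn_gt0 prime_gt0.
rewrite Dn in cpx *; apply: (cyc_prime_saturated pp pw) => //.
by move: n0; rewrite Dn muln_gt0 => /andP [].
Qed.

(** * Lowering the level by a prime *)

Lemma normr_unity_root (n : nat) (z : algC) : (0 < n)%N -> z ^+ n = 1 -> `|z| = 1.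
Proof.
by move=> n0 zn; apply/eqP; rewrite -(pexpr_eq1 n0) // -normrX zn normr1.
Qed.

Lemma conjC_unity_root (n : nat) (z : algC) : (0 < n)%N -> z ^+ n = 1 -> z^* = z^-1.
Proof.
by move=> n0 /(normr_unity_root n0) z1; rewrite invC_norm z1 expr1n invr1 mul1r.
Qed.

Lemma parseval (p : nat) (r : algC) (b : 'I_p -> algC) : p.-primitive_root r ->
  \sum_(j < p) `|\sum_(i < p) b i * r ^+ (i * j)| ^+ 2 = p%:R * \sum_(i < p) `|b i| ^+ 2.
Proof.
move=> pr; have p0 := prim_order_gt0 pr; have rp := prim_expr_order pr.
have r0 := unity_root_neq0 p0 rp.
have E (j : 'I_p) : `|\sum_(i < p) b i * r ^+ (i * j)| ^+ 2 =
    \sum_(i < p) \sum_(l < p) b i * (b l)^* * (r ^+ i / r ^+ l) ^+ j.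
  rewrite normCK rmorph_sum /= mulr_suml; apply: eq_bigr => i _.
  rewrite mulr_sumr; apply: eq_bigr => l _.
  rewrite rmorphM rmorphXn /= (conjC_unity_root p0 rp) expr_div_n -!exprM exprVn.
  by rewrite mulrACA.
under eq_bigr do rewrite E.
rewrite exchange_big mulr_sumr /=; apply: eq_bigr => i _.
rewrite exchange_big (bigD1 i) //= [X in _ + X]big1 ?addr0.
  under eq_bigr do rewrite divff ?expf_neq0 // expr1n mulr1.
  by rewrite sumr_const card_ord mulr_natl normCK.
move=> l li; rewrite -mulr_sumr sum_unity_powers.
  case: eqP => [E1|_]; last by rewrite mulr0.
  case/eqP: li; apply: val_inj => /=.
  have : r ^+ i == r ^+ l.
    by rewrite -subr_eq0 -[X in _ - X]mul1r -E1 divfK ?subrr // expf_neq0.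
  by rewrite (eq_prim_root_expr pr) => /eqP; rewrite !modn_small.
by rewrite expr_div_n !(exprAC _ _ p) rp !expr1n divr1.
Qed.

Lemma sum_sqr_norm_sub (p : nat) (b : 'I_p -> algC) :
  \sum_(i < p) \sum_(j < p) `|b i - b j| ^+ 2 =
  2%:R * (p%:R * \sum_(i < p) `|b i| ^+ 2 - `|\sum_(i < p) b i| ^+ 2).
Proof.
have E i j : `|b i - b j| ^+ 2 = `|b i| ^+ 2 + `|b j| ^+ 2 - (b i * (b j)^* + b j * (b i)^*).
  by rewrite !normCK rmorphB; ring.
have E1 : \sum_(i < p) \sum_(j < p) `|b i| ^+ 2 = p%:R * \sum_(i < p) `|b i| ^+ 2.
  by rewrite mulr_sumr; apply: eq_bigr => i _; rewrite sumr_const card_ord mulr_natl.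
have E2 : \sum_(i < p) \sum_(j < p) `|b j| ^+ 2 = p%:R * \sum_(i < p) `|b i| ^+ 2.
  by rewrite exchange_big E1.
have E3 : \sum_(i < p) \sum_(j < p) b i * (b j)^* = `|\sum_(i < p) b i| ^+ 2.
  by rewrite normCK rmorph_sum mulr_suml; apply: eq_bigr => i _; rewrite mulr_sumr.
have E4 : \sum_(i < p) \sum_(j < p) b j * (b i)^* = `|\sum_(i < p) b i| ^+ 2.
  by rewrite exchange_big E3.
transitivity (\sum_(i < p) \sum_(j < p) `|b i| ^+ 2 + \sum_(i < p) \sum_(j < p) `|b j| ^+ 2
   - (\sum_(i < p) \sum_(j < p) b i * (b j)^* + \sum_(i < p) \sum_(j < p) b j * (b i)^*)).
  rewrite -!big_split -sumrB /=; apply: eq_bigr => i _.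
  by rewrite -!big_split -sumrB /=; apply: eq_bigr => j _.
by rewrite E1 E2 E3 E4; ring.
Qed.

Lemma sum_ord_mul (p m : nat) (G : nat -> algC) :
  \sum_(k < p * m) G k = \sum_(i < m) \sum_(j < p) G (j * m + i)%N.
Proof.
rewrite exchange_big /=; elim: p => [|p IH]; first by rewrite !big_ord0.
rewrite big_ord_recr -IH /= -!(big_mkord xpredT) /= mulSn addnC.
rewrite (big_cat_nat (leq0n _) (leq_addr m _)) /=; congr (_ + _).
rewrite -[X in \sum_(X <= i < _) _]add0n big_addn addKn !big_mkord.
by apply: eq_bigr => i _; rewrite addnC.
Qed.

Section Level.
Variables (p m : nat) (y : algC).
Hypotheses (pp : prime p) (m0 : (0 < m)%N) (py : p.-primitive_root (y ^+ m)).

Lemma level_expr : y ^+ (p * m) = 1.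
Proof. by rewrite mulnC exprM (prim_expr_order py). Qed.

Lemma level_neq0 : y != 0.
Proof. by apply: unity_root_neq0 level_expr; rewrite muln_gt0 prime_gt0. Qed.

(** The y^i with i < p represent the classes of mu_(pm) modulo mu_m, whether or not p divides m. *)
Lemma level_index r : r ^+ (p * m) = 1 -> exists i : 'I_p, (r / y ^+ i) ^+ m = 1.
Proof.
rewrite mulnC exprM => /(prim_rootP py) [i Ei]; exists i.
by rewrite expr_div_n Ei [(y ^+ i) ^+ m]exprAC divff // !expf_neq0 // level_neq0.
Qed.

Lemma cyc_level_decomp x : cyc (p * m) x ->
  exists2 al : 'I_p -> algC, forall i, cyc m (al i) & x = \sum_(i < p) al i * y ^+ i.
Proof.
move=> [s [Hs ->]]; elim: s Hs => [|t s IH] /=.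
  move=> _; exists (fun=> 0); first by move=> _; apply: cyc0.
  by rewrite big_nil big1 // => i _; rewrite mul0r.
move=> /andP [/eqP /level_index [l El] /IH [al cal Es]].
exists (fun i => al i + (if i == l then t.1%:~R * (t.2 / y ^+ l) else 0)).
  move=> i; apply: cycD => //; case: eqP => _; last exact: cyc0.
  exact: cycZroot.
rewrite big_cons Es addrC.
under [RHS]eq_bigr do rewrite mulrDl.
rewrite big_split /=; congr (_ + _).
rewrite (bigD1 l) //= eqxx big1 ?addr0 => [|i /negbTE ->]; last by rewrite mul0r.
by rewrite -mulrA divfK // expf_neq0 // level_neq0.
Qed.

Section Energy.
Variable al : 'I_p -> algC.
Hypothesis cal : forall i, cyc m (al i).
Let x := \sum_(i < p) al i * y ^+ i.
(** Defined for every k, so that Parseval can sum over all lifts j * m + i of i; it is identified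
    with |tau_k x|^2 for k coprime to pm. *)
Let F (k : nat) := `|\sum_(i < p) tau m (k %% m) (al i) * y ^+ (i * k)| ^+ 2.

Lemma tau_level k : coprime k (p * m) -> `|tau (p * m) k x| ^+ 2 = F k.
Proof.
move=> ckn; congr (`|_| ^+ 2); rewrite /x rmorph_sum /=; apply: eq_bigr => i _.
rewrite rmorphM rmorphXn /= (tauE ckn level_expr) -exprM [(k * i)%N]mulnC; congr (_ * _).
have ckm : coprime k m by move: ckn; rewrite coprimeMr => /andP [].
apply: (aut_cyc_eq (n := m)) (cal i) => z zm.
rewrite (tauE ckn) ?tauE ?coprime_modl // ?expr_mod //.
by rewrite mulnC exprM zm expr1n.
Qed.

Lemma sum_level_all (i : 'I_m) :
  \sum_(j < p) F (j * m + i) = p%:R * \sum_(l < p) `|tau m i (al l)| ^+ 2.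
Proof.
have yi l : `|y ^+ (l * i)| = 1.
  have := normr_unity_root _ level_expr; rewrite normrX => -> //.
    by rewrite expr1n.
  by rewrite muln_gt0 prime_gt0.
transitivity (p%:R * \sum_(l < p) `|tau m i (al l) * y ^+ (l * i)| ^+ 2).
  rewrite -(parseval _ py); apply: eq_bigr => j _; congr (`|_| ^+ 2).
  apply: eq_bigr => l _; rewrite modnMDl modn_small // mulnDr exprD mulrA mulrAC.
  by congr (_ * _); rewrite -exprM [in RHS]mulnC mulnA.
by congr (_ * _); apply: eq_bigr => l _; rewrite normrM yi mulr1.
Qed.

Lemma coprime_level k j : coprime (j * m + k) m = coprime k m.
Proof. by rewrite -coprime_modl modnMDl coprime_modl. Qed.

(** Every lift to level pm of a unit modulo m is again a unit, so each block of the energy is a full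
    Parseval sum. *)
Lemma energy_level_ramified : (p %| m)%N ->
  energy (p * m) x = p%:R * \sum_(i < p) energy m (al i).
Proof.
move=> pm.
have ccop k : coprime k (p * m) = coprime k m.
  rewrite coprimeMr andbC; case ckm: (coprime k m) => //=.
  exact: coprime_dvdr pm ckm.
rewrite /energy.
under eq_bigl do rewrite ccop.
under eq_bigr => k ck do rewrite tau_level ?ccop //.
rewrite big_mkcond /= (sum_ord_mul _ _ (fun k => if coprime k m then F k else 0)).
rewrite [X in _ = _ * X]exchange_big mulr_sumr [RHS]big_mkcond /=; apply: eq_bigr => i _.
under eq_bigr do rewrite coprime_level.
case: ifP => _; last by rewrite big1.
exact: sum_level_all.
Qed.

(** Exactly one lift j0 of each unit i is divisible by p; there y^(j0 m + i) = 1 and the missing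
    term is the squared modulus of the sum of the conjugated al. Parseval minus this square is half
    the sum of the squared differences. *)
Lemma energy_level_unramified : ~~ (p %| m)%N -> p.-primitive_root y ->
  2%:R * energy (p * m) x = \sum_(i < p) \sum_(j < p) energy m (al i - al j).
Proof.
move=> pm yp.
have cpm : coprime p m by rewrite prime_coprime.
have E (i : 'I_m) : coprime i m ->
    \sum_(j < p | coprime (j * m + i) (p * m)) F (j * m + i) =
    p%:R * \sum_(l < p) `|tau m i (al l)| ^+ 2 - `|\sum_(l < p) tau m i (al l)| ^+ 2.
  move=> cim.
  have y0 := level_neq0.
  have [j0 Ej0] : exists j0 : 'I_p, y ^- i = (y ^+ m) ^+ j0.
    have : (y ^- i) ^+ p = 1.
      by rewrite exprVn exprAC (prim_expr_order yp) expr1n invr1.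
    by move=> /(prim_rootP py) [j0 ->]; exists j0.
  have y1 : y ^+ (j0 * m + i) = 1.
    by rewrite exprD mulnC exprM -Ej0 mulVf // expf_neq0.
  have cop (j : 'I_p) : coprime (j * m + i) (p * m) = (j != j0).
    rewrite coprimeMr coprime_level cim andbT coprime_sym prime_coprime //.
    rewrite (prim_order_dvd yp) exprD mulnC exprM; congr (~~ _).
    apply/eqP/eqP => [E1|->]; last by rewrite -exprM mulnC -exprD.
    apply: val_inj => /=; apply/eqP.
    have : (y ^+ m) ^+ j == (y ^+ m) ^+ j0.
      by rewrite -Ej0 -[X in X == _](mulfK (expf_neq0 i y0)) E1 mul1r.
    by rewrite (eq_prim_root_expr py) !modn_small.
  rewrite (eq_bigl _ _ cop) -sum_level_all [in RHS](bigD1 j0) //=.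
  have -> : F (j0 * m + i) = `|\sum_(l < p) tau m i (al l)| ^+ 2.
    congr (`|_| ^+ 2); apply: eq_bigr => l _.
    by rewrite modnMDl modn_small // mulnC exprM y1 expr1n mulr1.
  by rewrite [X in X - _]addrC addrK.
have -> : energy (p * m) x = \sum_(i < m | coprime i m)
    (p%:R * \sum_(l < p) `|tau m i (al l)| ^+ 2 - `|\sum_(l < p) tau m i (al l)| ^+ 2).
  rewrite /energy; under eq_bigr => k ck do rewrite tau_level //.
  rewrite big_mkcond /= (sum_ord_mul _ _ (fun k => if coprime k (p * m) then F k else 0)).
  rewrite [RHS]big_mkcond /=; apply: eq_bigr => i _.
  rewrite -big_mkcond /=; case: ifP => ci; first exact: E.
  apply: big_pred0 => j; apply/negbTE.
  by rewrite coprimeMr coprime_level ci andbF.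
rewrite mulr_sumr; under eq_bigr do rewrite -sum_sqr_norm_sub.
rewrite exchange_big /=; apply: eq_bigr => i _; rewrite exchange_big /=.
by apply: eq_bigr => j _; apply: eq_bigr => k _; rewrite rmorphB.
Qed.
End Energy.
End Level.

(** If p divides m, a primitive pm-th root w serves; otherwise w^m, a primitive p-th root whose m-th
    power is again primitive. *)
Lemma level_root_exists p m : prime p -> (0 < m)%N ->
  exists y : algC, p.-primitive_root (y ^+ m) /\ (~~ (p %| m)%N -> p.-primitive_root y).
Proof.
move=> pp m0; have n0 : (0 < p * m)%N by rewrite muln_gt0 prime_gt0.
have [w pw] := C_prim_root_exists n0.
have pwm : p.-primitive_root (w ^+ m).
  by have := dvdn_prim_root pw (dvdn_mulr m (dvdnn p)); rewrite mulKn ?prime_gt0.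
have [pm|npm] := boolP (p %| m)%N; first by exists w.
by exists (w ^+ m); rewrite prim_root_exp_coprime // coprime_sym prime_coprime.
Qed.

Lemma energy1 n : energy n 1 = (totient n)%:R.
Proof.
rewrite -card_coprime -sum1_card natr_sum; apply: eq_bigr => k _.
by rewrite rmorph1 normr1 expr1n.
Qed.

Lemma energyN n x : energy n (- x) = energy n x.
Proof. by apply: eq_bigr => k _; rewrite rmorphN normrN. Qed.

Lemma totient_ramified p m : prime p -> (0 < m)%N -> (p %| m)%N ->
  totient (p * m) = (p * totient m)%N.
Proof.
move=> pp m0 pm; have [y [py _]] := level_root_exists pp m0.
have p0 := prime_gt0 pp.
pose i0 := Ordinal p0; pose al (i : 'I_p) : algC := (i == i0)%:R.
have cal i : cyc m (al i) by apply: cyc_nat.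
apply/eqP; rewrite -(eqr_nat algC) natrM -!energy1; apply/eqP.
have := energy_level_ramified pp m0 py cal pm.
rewrite (bigD1 i0) //= big1 ?addr0 => [|i /negbTE ni]; last by rewrite /al ni mul0r.
rewrite /al eqxx mulr1 => ->; congr (_ * _).
rewrite (bigD1 i0) //= big1 ?addr0 ?eqxx // => i /negbTE ->; exact: energy0.
Qed.

Lemma totient_unramified p m : prime p -> ~~ (p %| m)%N ->
  totient (p * m) = (p.-1 * totient m)%N.
Proof.
by move=> pp pm; rewrite totient_coprime ?prime_coprime // totient_prime.
Qed.

(** This alternative drives both descents on the level. If every prime factor of n is at most b and
    occurs once, n divides b!; any other prime factor can be stripped. *)
Lemma dvdn_fact_or_prime b n : (0 < n)%N -> (n %| b`!)%N \/
  exists p, [/\ prime p, (p %| n)%N & (p %| n %/ p)%N \/ (b < p)%N].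
Proof.
move=> n0.
case: (boolP (all (fun p => ~~ (p %| n %/ p) && (p <= b))%N (primes n))) => [/allP H|].
  left; apply/dvdn_partP => // p pn; have /andP [H1 H2] := H p pn.
  have [pp dpn] : prime p /\ (p %| n)%N by move: pn; rewrite mem_primes n0 => /and3P [].
  have -> : (n`_p)%N = p.
    rewrite p_part; have : (logn p n < 2)%N.
      rewrite ltnNge; apply: contra H1 => H1.
      by rewrite dvdn_divRL // mulnn pfactor_dvdn.
    have : (0 < logn p n)%N by rewrite logn_gt0.
    by case: (logn p n) => [|[|]].
  by rewrite dvdn_fact // prime_gt0.
move=> /allPn [p]; rewrite mem_primes n0 => /and3P [pp _ pn] H; right; exists p; split=> //.
by move: H; rewrite negb_and negbK -ltnNge => /orP.
Qed.

Definition nnz (p : nat) (al : 'I_p -> algC) : nat := #|[pred i | al i != 0]|.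

Section LoxtonStep.
Variables (C t p m : nat).
Hypotheses (C0 : (0 < C)%N) (tC : (t <= C.*2)%N) (pp : prime p) (m0 : (0 < m)%N).
Let n := (p * m)%N.
Let n0 : (0 < n)%N. Proof. by rewrite muln_gt0 prime_gt0. Qed.
Let phi : algC := (totient m)%:R.
Let phi0 : 0 < phi. Proof. by rewrite ltr0n totient_gt0. Qed.

(** With two nonzero coefficients, each coefficient leaves another one of energy at least phi, so
    its own doubled energy is at most (t + 1 - 2) phi; the slack in t + 1 is the price of the
    shift. *)
Let level_split (al : 'I_p -> algC) :
  [/\ forall i, cyc m (al i), (nnz al <= C.*2)%N,
    (nnz al <= 1)%N -> 2%:R * (\sum_i energy m (al i)) <= t%:R * phi
  & 2%:R * (\sum_i energy m (al i)) <= t.+1%:R * phi] ->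
  (nnz al <= C.*2)%N /\
  ((nnz al <= 1)%N /\
    (forall i, 2%:R * energy m (al i) <= t%:R * phi) \/
   (0 < t)%N /\ (forall i, 2%:R * energy m (al i) <= t.-1%:R * phi)).
Proof.
move=> [cal HX H1 H2]; split=> //.
have [X1|X2] := leqP (nnz al) 1.
  left; split=> // i; apply: le_trans (H1 X1).
  by rewrite ler_pM2l ?ltr0n // (bigD1 i) //= lerDl sumr_ge0 // => j _; apply: energy_ge0.
right.
have other i : exists2 j, j != i & al j != 0.
  have : (0 < #|[predD1 [pred i | al i != 0%R] & i]|)%N.
    by move: X2; rewrite /nnz (cardD1 i); case: (i \in _); rewrite ?add1n ?add0n // => /ltnW.
  by case/card_gt0P => j; rewrite !inE => /andP [ji aj]; exists j.
have bound i : 2%:R * energy m (al i) + 2%:R * phi <= t.+1%:R * phi.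
  have [j ji aj] := other i; apply: le_trans H2.
  rewrite -mulrDr ler_pM2l ?ltr0n // (bigD1 i) //= lerD2l (bigD1 j) //=.
  apply: le_trans (energy_ge_totient m0 (cal j) aj) _.
  by rewrite lerDl sumr_ge0 // => l _; apply: energy_ge0.
have t0 : (0 < t)%N.
  have [i ai] : exists i, al i != 0 by have [j _ aj] := other (Ordinal (prime_gt0 pp)); exists j.
  have : 2%:R * phi + 2%:R * phi <= t.+1%:R * phi.
    apply: le_trans (bound i); rewrite lerD2r ler_pM2l ?ltr0n //.
    exact: energy_ge_totient.
  by rewrite -mulrDl ler_pM2r // -natrD ler_nat; case: (t).
split=> // i; have := bound i; rewrite -[in X in _ <= X -> _](prednK t0) -lerBrDr.
by rewrite -mulrBl -natrB // subSS subn1.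
Qed.

(* If p does not divide m the expansion is unique only up to adding the same
   element to every coefficient; the most frequent coefficient is shifted to 0. *)
Lemma loxton_step x : (p %| m)%N \/ (C.*2 * (C.*2).+1 <= p)%N ->
  cyc n x -> 2%:R * energy n x <= t%:R * (totient n)%:R ->
  exists (y : algC) (al : 'I_p -> algC),
  [/\ y ^+ n = 1, x = \sum_i al i * y ^+ i, forall i, cyc m (al i),
   (nnz al <= C.*2)%N &
   (nnz al <= 1)%N /\
    (forall i, 2%:R * energy m (al i) <= t%:R * phi) \/
   (0 < t)%N /\ (forall i, 2%:R * energy m (al i) <= t.-1%:R * phi)].
Proof.
move=> pm_or cx Ex; have p0 := prime_gt0 pp.
have [y [py py']] := level_root_exists pp m0.
have [al cal Dx] := cyc_level_decomp pp m0 py cx.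
have energy_count (be : 'I_p -> algC) : (forall i, cyc m (be i)) ->
    (nnz be)%:R * phi <= \sum_i energy m (be i).
  move=> cbe; rewrite /nnz mulr_natl -sumr_const [X in X <= _]big_mkcond /=.
  apply: ler_sum => i _; rewrite inE; case: ifP => bi; last exact: energy_ge0.
  exact: energy_ge_totient.
have [pm|npm] := boolP (p %| m)%N.
  have E := energy_level_ramified pp m0 py cal pm.
  have Hs : 2%:R * (\sum_i energy m (al i)) <= t%:R * phi.
    move: Ex; rewrite Dx E totient_ramified // natrM mulrCA [t%:R * _]mulrCA.
    by rewrite ler_pM2l ?ltr0n.
  have [|HX H] := level_split (al := al).
    split=> //.
    - have : 2%:R * (nnz al)%:R * phi <= t%:R * phi.
        by apply: le_trans Hs; rewrite -mulrA ler_pM2l ?ltr0n // energy_count.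
      rewrite ler_pM2r // -natrM ler_nat mul2n => H; apply: leq_trans tC.
      by apply: leq_trans H; rewrite -addnn leq_addr.
    - by apply: le_trans Hs _; rewrite ler_pM2r // ler_nat.
  by exists y, al; split=> //; apply: level_expr.
case: pm_or => [|p_big]; first by rewrite (negbTE npm).
have {}py' := py' npm.
have Cp : (C.*2 < p)%N.
  by apply: leq_trans p_big; move: C0; nia.
have Et : (totient n)%:R = (p%:R - 1) * phi :> algC.
  by rewrite totient_unramified // natrM -subn1 natrB.
have E2 (be : 'I_p -> algC) : (forall i, cyc m (be i)) -> x = \sum_i be i * y ^+ i ->
    \sum_i \sum_j energy m (be i - be j) <= t%:R * ((p%:R - 1) * phi).
  by move=> cbe Db; rewrite -(energy_level_unramified pp m0 py cbe npm py') -Db -Et.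
(* Averaging: if every coefficient differed from more than 2C others, the sum over pairs would be at
   least p (2C + 1) phi, too much since t <= 2C. *)
have [i0 Hi0] : exists i0, (nnz (fun i => (al i - al i0)%R) <= C.*2)%N.
  case: (pickP (fun i0 => nnz (fun i => (al i - al i0)%R) <= C.*2)%N) => [i0 ?|H]; first by exists i0.
  have : p%:R * (C.*2.+1%:R * phi) <= t%:R * ((p%:R - 1) * phi).
    apply: le_trans (E2 al cal Dx); rewrite exchange_big /= mulr_natl -{1}(card_ord p) -sumr_const.
    apply: ler_sum => i _; apply: le_trans (energy_count (fun j => al j - al i) _); last first.
      by move=> j; apply: cycB.
    by rewrite ler_pM2r // ler_nat ltnNge (negbT (H i)).
  rewrite !mulrA ler_pM2r // -(natrB _ p0) -!natrM ler_nat => Hc.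
  by move: tC p0; nia.
pose be i := al i - al i0.
have cbe i : cyc m (be i) by apply: cycB.
(* The y^i sum to 0, as y is a primitive p-th root of unity, so the shift does not change x. *)
have Db : x = \sum_i be i * y ^+ i.
  rewrite /be; under eq_bigr do rewrite mulrBl.
  rewrite sumrB -mulr_sumr sum_unity_powers ?(prim_expr_order py') //.
  case: eqP => [y1|_]; last by rewrite mulr0 subr0.
  have := prim_order_dvd py' 1; rewrite y1 expr1 eqxx dvdn1 => /eqP p1.
  by exfalso; move: (prime_gt1 pp); rewrite p1.
have HX : (nnz be <= C.*2)%N by [].
set X := nnz be in HX; pose Z := #|[pred i | be i == 0]|.
have XZ : (X + Z)%N = p.
  rewrite -[RHS](card_ord p) -(cardC [pred i | be i != 0%R]); congr (_ + _)%N.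
  by apply: eq_card => i; rewrite !inE negbK.
(* Among the pairs, each of the Z zero coefficients meets the total energy twice, once in each
   position. *)
have HZ : 2%:R * (Z%:R * \sum_i energy m (be i)) <= t%:R * ((p%:R - 1) * phi).
  apply: le_trans (E2 be cbe Db).
  have EZ : \sum_i \sum_(j | be j == 0) energy m (be i) = Z%:R * \sum_i energy m (be i).
    by rewrite mulr_sumr; apply: eq_bigr => i _; rewrite sumr_const mulr_natl.
  have EZ' : \sum_(i | be i == 0) \sum_j energy m (be j) = Z%:R * \sum_i energy m (be i).
    by rewrite sumr_const mulr_natl.
  rewrite -[2%:R]/(1 + 1)%:R natrD mulrDl !mul1r -{1}EZ -EZ' [X in _ + X]big_mkcond -big_split /=.
  apply: ler_sum => i _; rewrite [X in X + _]big_mkcond /=.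
  case: eqP => [->|_]; last first.
    rewrite addr0; apply: ler_sum => j _; case: eqP => [->|_]; rewrite ?subr0 //.
    exact: energy_ge0.
  rewrite -big_split /=; apply: ler_sum => j _.
  by rewrite energy0 if_same add0r sub0r energyN.
have p1 : 0 < (p%:R - 1 : algC) by rewrite subr_gt0 ltr1n prime_gt1.
have S0 : 0 <= \sum_i energy m (be i) by rewrite sumr_ge0 // => i _; apply: energy_ge0.
have [|_ H] := level_split (al := be).
  split=> //.
  - move=> X1; rewrite -(ler_pM2l p1) [X in _ <= X]mulrCA; apply: le_trans HZ.
    rewrite mulrCA ler_pM2l ?ltr0n // ler_wpM2r //.
    rewrite -(natrB _ p0) ler_nat; move: X1 XZ; rewrite -/X; lia.
  (* At least p - 2C coefficients are 0. With t <= 2C, the threshold p >= 2C (2C + 1) ensures t (p -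
     1) <= (t + 1) (p - 2C). *)
  - have pC : 0 < (p - C.*2)%:R :> algC by rewrite ltr0n subn_gt0.
    rewrite -(ler_pM2l pC) mulrCA; apply: le_trans (_ : 2%:R * (Z%:R * \sum_i energy m (be i)) <= _).
      rewrite ler_pM2l ?ltr0n // ler_wpM2r // ler_nat; lia.
    apply: le_trans HZ _; rewrite !mulrA ler_pM2r // -(natrB _ p0) -!natrM ler_nat.
    by nia.
by exists y, be; split=> //; apply: level_expr.
Qed.
End LoxtonStep.

(** * Loxton's theorem for cyclotomic integers *)

Lemma bounded_int_finite (b : nat) : exists E : seq algC,
  forall a, a \in Num.int -> `|a| <= b%:R -> a \in E.
Proof.
exists ([seq k%:R | k <- iota 0 b.+1] ++ [seq - k%:R | k <- iota 0 b.+1]) => a.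
move=> /intrP [[k|k] ->].
  rewrite normr_nat ler_nat => kb; rewrite mem_cat; apply/orP; left.
  by apply/mapP; exists k => //; rewrite mem_iota.
rewrite NegzE rmorphN normrN normr_nat ler_nat => kb; rewrite mem_cat; apply/orP; right.
by apply/mapP; exists k.+1 => //; rewrite mem_iota.
Qed.

Lemma finite_fun_seq (T : eqType) (n : nat) (E : seq T) : exists L : seq (seq T),
  forall f : 'I_n -> T, (forall i, f i \in E) -> [seq f i | i <- enum 'I_n] \in L.
Proof.
elim: n => [|n [L HL]].
  by exists [:: [::]] => f _; rewrite inE -size_eq0 size_map size_enum_ord.
exists [seq x :: l | x <- E, l <- L] => f Hf.
by rewrite enum_ordSl /= -map_comp; apply: allpairs_f; [apply: Hf | apply: HL].
Qed.

(** The coefficients of the trace expansion determine x and are integers bounded in terms of C and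
    n. *)
Lemma cyc_energy_finite (C n : nat) : (0 < n)%N -> exists E : seq algC,
  forall x, cyc n x -> energy n x <= (C * totient n)%:R -> x \in E.
Proof.
move=> n0; have [w pw] := C_prim_root_exists n0; have wn := prim_expr_order pw.
have [T HT] := bounded_int_finite (totient n * (C * totient n).+1).
have [L HL] := @finite_fun_seq _ n T.
exists [seq n%:R^-1 * \sum_(i < n) l`_i * w ^+ i | l <- L] => x cx Ex.
pose f (i : 'I_n) := \sum_(k < n | coprime k n) tau n k (x * w ^- i).
have wi (i : 'I_n) : (w ^- i) ^+ n = 1 by apply: unity_rootV; rewrite exprAC wn expr1n.
have cxi (i : 'I_n) : cyc n (x * w ^- i) by apply: cycM cx (cyc_root (wi i)).
apply/mapP; exists [seq f i | i <- enum 'I_n]; last first.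
  apply: (mulfI (_ : n%:R != 0)); first by rewrite pnatr_eq0 -lt0n.
  rewrite mulVKf ?pnatr_eq0 -?lt0n // (cyc_trace_expansion pw (cyc_inQcyc cx)).
  apply: eq_bigr => i _; congr (_ * _).
  by rewrite (nth_map i) ?size_enum_ord // nth_ord_enum.
apply: HL => i; apply: HT.
  by apply: cyc_trace_int => //; [apply: cyc_inQcyc | apply: cyc_Aint (cxi i)].
apply: le_trans (ler_norm_sum _ _ _) _.
rewrite natrM -card_coprime mulr_natl -sumr_const.
rewrite [X in _ <= X](eq_bigl (fun k : 'I_n => coprime k n)); last by move=> k; rewrite inE.
apply: ler_sum => k ck; rewrite rmorphM normrM.
have -> : `|tau n k (w ^- i)| = 1.
  by apply: (normr_unity_root n0); rewrite -rmorphXn wi rmorph1.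
rewrite mulr1; have le : `|tau n k x| ^+ 2 <= (C * totient n)%:R.
  apply: le_trans Ex; rewrite /energy (bigD1 k) //= lerDl sumr_ge0 // => j _.
  by rewrite exprn_ge0.
rewrite card_coprime; have [l1|l1] := real_leP (normr_real (tau n k x)) (real1 _).
  by apply: le_trans l1 _; rewrite ler1n.
apply: le_trans (_ : (C * totient n)%:R <= _); last by rewrite ler_nat.
by apply: le_trans le; rewrite ler_eXnr // ltW.
Qed.

Lemma cyc_energy_finite_le (C b : nat) : exists E : seq algC,
  forall n x, (0 < n <= b)%N -> cyc n x -> energy n x <= (C * totient n)%:R -> x \in E.
Proof.
elim: b => [|b [E HE]]; first by exists [::] => n x; case: n.
have [E' HE'] := cyc_energy_finite C (ltn0Sn b).
exists (E ++ E') => n x /andP [n0]; rewrite leq_eqVlt => /orP [/eqP -> cx Ex|nb cx Ex].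
  by rewrite mem_cat HE' ?orbT.
by rewrite mem_cat (HE n) // n0.
Qed.

Definition runity (z : algC) := exists2 n, (0 < n)%N & z ^+ n = 1.

Lemma runity_common (s : seq algC) : (forall z, z \in s -> runity z) ->
  exists2 n, (0 < n)%N & forall z, z \in s -> z ^+ n = 1.
Proof.
elim: s => [|z s IH] H; first by exists 1%N.
have [n n0 zn] := H z (mem_head _ _).
have [|m m0 sm] := IH; first by move=> v vs; apply: H; rewrite inE vs orbT.
exists (n * m)%N; first by rewrite muln_gt0 n0.
move=> v; rewrite inE => /orP [/eqP ->|/sm vm]; first by rewrite exprM zn expr1n.
by rewrite mulnC exprM vm expr1n.
Qed.

Lemma runity1 : runity 1.
Proof. by exists 1%N. Qed.

Lemma runityM x y : runity x -> runity y -> runity (x * y).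
Proof.
move=> [n n0 xn] [m m0 ym]; exists (n * m)%N; first by rewrite muln_gt0 n0.
by rewrite exprMn {2}mulnC !exprM xn ym !expr1n mulr1.
Qed.

Lemma runityV x : runity x -> runity x^-1.
Proof. by move=> [n n0 xn]; exists n; rewrite // exprVn xn invr1. Qed.

Lemma runityX x k : runity x -> runity (x ^+ k).
Proof. by move=> [n n0 xn]; exists n; rewrite // exprAC xn expr1n. Qed.

Lemma runity_neq0 x : runity x -> x != 0.
Proof. by move=> [n n0]; apply: unity_root_neq0. Qed.

Definition unity_comb (B : nat) (E : seq algC) (x : algC) := exists s : seq (algC * algC),
  [/\ (size s <= B)%N, forall u, u \in s -> u.1 \in E /\ runity u.2
     & x = \sum_(u <- s) u.1 * u.2].

Lemma unity_comb_leq B B' E x : (B <= B')%N -> unity_comb B E x -> unity_comb B' E x.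
Proof. by move=> le [s [Hs H1 H2]]; exists s; split=> //; apply: leq_trans le. Qed.

Lemma unity_comb_mul B E x r : runity r -> unity_comb B E x -> unity_comb B E (x * r).
Proof.
move=> rr [s [Hs H1 ->]]; exists [seq (u.1, u.2 * r) | u <- s]; split.
- by rewrite size_map.
- move=> _ /mapP [u /H1 [uE ur] ->]; split=> //; exact: runityM.
- by rewrite big_map mulr_suml; apply: eq_bigr => u _ /=; rewrite mulrA.
Qed.

Lemma unity_comb_sum (I : finType) (A : {pred I}) B E (f : I -> algC) :
  (forall i, i \in A -> unity_comb B E (f i)) ->
  unity_comb (#|A| * B) E (\sum_(i in A) f i).
Proof.
move=> H; rewrite cardE -big_enum.
have : forall i, i \in enum A -> unity_comb B E (f i) by move=> i; rewrite mem_enum; apply: H.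
elim: (enum A) => [|i s IH] {}H; first by rewrite big_nil; exists [::]; rewrite big_nil.
have [|t [Ht1 Ht2 Ht3]] := IH; first by move=> j js; apply: H; rewrite inE js orbT.
have [|u [Hu1 Hu2 Hu3]] := H i; first exact: mem_head.
exists (u ++ t); rewrite size_cat mulSn leq_add // big_cons big_cat -Hu3 -Ht3; split=> //.
by move=> v; rewrite mem_cat => /orP [/Hu2|/Ht2].
Qed.

(** Induction on t, then on the level. A step that keeps t leaves at most one term, so it costs
    nothing; a step that lowers t multiplies the number of terms by at most 2C. At levels dividing
    b! only finitely many values occur, and they form E. *)
Theorem loxton_cyclotomic (C : nat) : exists B E, forall n x, (0 < n)%N -> cyc n x ->
  energy n x <= (C * totient n)%:R -> unity_comb B E x.
Proof.
wlog C0 : C / (0 < C)%N.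
  move=> H; have [B [E HE]] := H C.+1 isT; exists B, E => n x n0 cx Ex; apply: (HE n) => //.
  by apply: le_trans Ex _; rewrite ler_nat leq_mul2r leqnSn orbT.
pose b := (C.*2 * C.*2.+1)%N.
have [E HE] := cyc_energy_finite_le C b`!.
(* At most 2C drops of t, each with a factor below 2C + 1. *)
exists (C.*2.+1 ^ C.*2)%N, E => n x n0 cx Ex.
suff H t : (t <= C.*2)%N -> forall n x, (0 < n)%N -> cyc n x ->
    2%:R * energy n x <= t%:R * (totient n)%:R -> unity_comb (C.*2.+1 ^ t) E x.
  apply: (H C.*2 (leqnn _) n) => //.
  by rewrite -natrM -mul2n -mulnA natrM ler_pM2l ?ltr0n.
elim/ltn_ind: t {n x n0 cx Ex} => t IHt tC n; elim/ltn_ind: n => n IHn x n0 cx Ex.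
have [nb|[p [pp pn pm_or]]] := dvdn_fact_or_prime b n0.
  exists [:: (x, 1)]; split=> /=; first by rewrite expn_gt0.
  - move=> u; rewrite inE => /eqP -> /=; split; last exact: runity1.
    apply: (HE n) => //; first by rewrite n0 dvdn_leq ?fact_gt0.
    rewrite -(ler_pM2l (_ : 0 < 2%:R)) ?ltr0n //; apply: le_trans Ex _.
    by rewrite -!natrM ler_nat mulnA mul2n leq_mul2r tC orbT.
  - by rewrite big_seq1 mulr1.
have Dn : n = (p * (n %/ p))%N by rewrite mulnC divnK.
set m := (n %/ p)%N in Dn pm_or.
have m0 : (0 < m)%N by move: n0; rewrite Dn muln_gt0 => /andP [].
have mn : (m < n)%N by rewrite Dn ltn_Pmull ?prime_gt1.
have pm_or' : (p %| m)%N \/ (b <= p)%N by case: pm_or => [|/ltnW]; [left|right].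
rewrite Dn in cx Ex.
have [y [al [yn -> cal nz step]]] := loxton_step C0 tC pp m0 pm_or' cx Ex.
have -> : \sum_i al i * y ^+ i = \sum_(i in [pred i | al i != 0]) al i * y ^+ i.
  rewrite [RHS]big_mkcond /=; apply: eq_bigr => i _; rewrite inE.
  by case: eqP => [->|_]; rewrite ?mul0r.
have yi i : runity (y ^+ i).
  by apply: runityX; exists (p * m)%N; rewrite // -Dn.
case: step => [[nz1 Hal]|[t0 Hal]].
  apply: (@unity_comb_leq (nnz al * C.*2.+1 ^ t)).
    by rewrite -[X in (_ <= X)%N]mul1n leq_mul2r nz1 orbT.
  apply: unity_comb_sum => i _; apply: unity_comb_mul => //.
  exact: (IHn m).
have tlt : (t.-1 < t)%N by rewrite ltn_predL.
apply: (@unity_comb_leq (nnz al * C.*2.+1 ^ t.-1)).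
  rewrite -[in X in (_ <= X)%N](prednK t0) expnS leq_mul2r; apply/orP; right.
  exact: leqW.
apply: unity_comb_sum => i _; apply: unity_comb_mul => //.
by apply: (IHt t.-1 tlt _ m) => //; apply: leq_trans tC; apply: leq_pred.
Qed.

(** * Vanishing sums of roots of unity *)

Lemma energy_eq0 n x : (0 < n)%N -> cyc n x -> energy n x = 0 -> x = 0.
Proof.
move=> n0 cx E; apply/eqP/negPn/negP => x0.
have := energy_ge_totient n0 cx x0.
by rewrite E lern0 gtn_eqF // totient_gt0.
Qed.

Lemma energy_sum_eq0 (I : finType) n (f : I -> algC) : (0 < n)%N ->
  (forall i, cyc n (f i)) -> \sum_i energy n (f i) = 0 -> forall i, f i = 0.
Proof.
move=> n0 cf H i; apply: (energy_eq0 n0 (cf i)).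
by apply: (psumr_eq0P _ H) => // j _; apply: energy_ge0.
Qed.

(** The energy of the sum is 0. If p divides m all coefficients vanish; otherwise all their
    differences do, and one zero coefficient settles the rest. *)
Lemma level_vanish p m y (al : 'I_p -> algC) : prime p -> (0 < m)%N ->
  p.-primitive_root (y ^+ m) -> (~~ (p %| m)%N -> p.-primitive_root y) ->
  (forall i, cyc m (al i)) -> (p %| m)%N \/ (exists i, al i = 0) ->
  \sum_(i < p) al i * y ^+ i = 0 -> forall i, al i = 0.
Proof.
move=> pp m0 py py' cal H E; have [pm|npm] := boolP (p %| m)%N.
  apply: (energy_sum_eq0 m0 cal).
  have := energy_level_ramified pp m0 py cal pm; rewrite E energy0 => /esym/eqP.
  by rewrite mulf_eq0 pnatr_eq0 gtn_eqF ?prime_gt0 // => /eqP.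
case: H => [|[i0 ai0]]; first by rewrite (negbTE npm).
have := energy_level_unramified pp m0 py cal npm (py' npm).
rewrite E energy0 mulr0 => /esym H i.
have H1 : \sum_l energy m (al i - al l) = 0.
  apply: (psumr_eq0P _ H) => // j _; apply: sumr_ge0 => l _; exact: energy_ge0.
have /(_ i0) := energy_sum_eq0 m0 (fun j => cycB (cal i) (cal j)) H1.
by rewrite ai0 subr0.
Qed.

(** Induction on a common order n of the roots. If n divides b!, all terms lie in one class.
    Otherwise a prime p is stripped and terms are grouped by powers of y; when p > b, at most b
    terms cannot fill p groups, so [level_vanish] applies and each group vanishes. *)
Theorem mann_cosets (b W : nat) (s : seq (int * algC)) : (b`! %| W)%N ->
  (forall t, t \in s -> runity t.2) -> (size s <= b)%N ->
  \sum_(t <- s) t.1%:~R * t.2 = 0 ->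
  forall r, r != 0 -> \sum_(t <- s | (t.2 / r) ^+ W == 1) t.1%:~R * t.2 = 0.
Proof.
move=> bW us; have [|n n0 Hn] := @runity_common [seq t.2 | t <- s].
  by move=> _ /mapP [t ts ->]; apply: us.
have {us} Hn t : t \in s -> t.2 ^+ n = 1 by move=> ts; apply: Hn; apply: map_f.
elim/ltn_ind: n s n0 Hn => n IH s n0 Hs sb E r r0.
have [nb|[p [pp pn pm_or]]] := dvdn_fact_or_prime b n0.
  have cond t : t \in s -> ((t.2 / r) ^+ W == 1) = (r ^- W == 1).
    move=> /Hs tn; rewrite expr_div_n; have /dvdnP [d ->] := dvdn_trans nb bW.
    by rewrite mulnC exprM tn expr1n mul1r.
  rewrite big_seq_cond (eq_bigl (fun t => (t \in s) && (r ^- W == 1))).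
    case: (r ^- W == 1); last by rewrite big_pred0 // => t; rewrite andbF.
    by under eq_bigl do rewrite andbT; rewrite -big_seq.
  by move=> t; case ts: (t \in s) => //=; apply: cond.
have Dn : n = (p * (n %/ p))%N by rewrite mulnC divnK.
set m := (n %/ p)%N in Dn pm_or.
have m0 : (0 < m)%N by move: n0; rewrite Dn muln_gt0 => /andP [].
have mn : (m < n)%N by rewrite Dn ltn_Pmull ?prime_gt1.
have [y [py py']] := level_root_exists pp m0.
have y0 := level_neq0 pp m0 py.
pose idx (t : int * algC) : 'I_p :=
  odflt (Ordinal (prime_gt0 pp)) [pick i : 'I_p | (t.2 / y ^+ i) ^+ m == 1].
have idxP t : t \in s -> (t.2 / y ^+ idx t) ^+ m = 1.
  move=> ts; rewrite /idx; case: pickP => [i /eqP //|H].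
  have [|i Hi] := @level_index p m y pp m0 py t.2; first by rewrite -Dn Hs.
  by have := H i; rewrite Hi eqxx.
pose si (i : 'I_p) := [seq (t.1, t.2 / y ^+ i) | t <- s & idx t == i].
pose al i := \sum_(u <- si i) u.1%:~R * u.2.
have alE i : al i = \sum_(t <- s | idx t == i) t.1%:~R * (t.2 / y ^+ i).
  by rewrite /al big_map big_filter.
have siP i u : u \in si i -> u.2 ^+ m = 1.
  by move=> /mapP [t]; rewrite mem_filter => /andP [/eqP <- ts] ->; apply: idxP.
have cal i : cyc m (al i).
  by apply: cyc_sum_seq => u /siP um; apply: cycZroot.
have Eal : \sum_(i < p) al i * y ^+ i = 0.
  rewrite -[RHS]E [RHS](partition_big idx xpredT) //=; apply: eq_bigr => i _.
  by rewrite alE mulr_suml; apply: eq_bigr => t _; rewrite -mulrA divfK // expf_neq0.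
have al0 : forall i, al i = 0.
  apply: (level_vanish pp m0 py py' cal _ Eal).
  case: pm_or => [|bp]; [by left | right].
  have [i Hi] : exists i, i \notin [seq idx t | t <- s].
    apply/existsP; rewrite -negb_forall; apply/negP => /forallP H.
    have : (#|'I_p| <= size [seq idx t | t <- s])%N.
      by apply: leq_trans (card_size _); apply/subset_leq_card/subsetP => i _; apply: H.
    by rewrite size_map card_ord leqNgt (leq_ltn_trans sb bp).
  exists i; rewrite alE big_seq_cond big_pred0 // => t; apply/negbTE.
  by apply: contra Hi => /andP [ts /eqP <-]; apply: map_f.
rewrite (partition_big idx xpredT) //= big1 // => i _.
have szi : (size (si i) <= b)%N.
  by apply: leq_trans sb; rewrite size_map size_filter count_size.
have ri0 : r / y ^+ i != 0 by rewrite mulf_neq0 ?invr_eq0 ?expf_neq0.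
have := IH m mn (si i) m0 (siP i) szi (al0 i) _ ri0.
rewrite big_map big_filter_cond => H.
move: (congr1 ( *%R^~ (y ^+ i)) H); rewrite /= mul0r mulr_suml => H'.
rewrite -[RHS]H'; apply: eq_big => [t|t _] /=; last by rewrite -mulrA divfK // expf_neq0.
rewrite andbC; congr (_ && (_ ^+ _ == _)).
by rewrite invfM invrK mulrACA mulVf ?mulr1 // expf_neq0.
Qed.

(** * Vanishing sums with arbitrary coefficients, through the field generated by all roots of
    unity *)

Definition Qab x := exists2 n, (0 < n)%N & inQcyc n x.

Lemma Qab_common (I : finType) (f : I -> algC) : (forall i, Qab (f i)) ->
  exists n d, [/\ (0 < n)%N, (0 < d)%N & forall i, cyc n (d%:R * f i)].
Proof.
move=> H; suff [n [d [n0 d0 Hd]]] : exists n d, [/\ (0 < n)%N, (0 < d)%N &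
    forall i, i \in enum I -> cyc n (d%:R * f i)].
  by exists n, d; split=> // i; apply: Hd; rewrite mem_enum.
elim: (enum I) => [|i s [n [d [n0 d0 Hd]]]]; first by exists 1%N, 1%N.
have [m m0 [e e0 ce]] := H i.
exists (m * n)%N, (d * e)%N; rewrite !muln_gt0 m0 n0 d0 e0; split=> // j.
rewrite inE => /orP [/eqP ->|/Hd cj].
  rewrite natrM -mulrA; apply: cycM; first exact: cyc_nat.
  by apply: cyc_dvd ce; rewrite dvdn_mulr.
rewrite [(d * e)%N]mulnC natrM -mulrA; apply: cycM; first exact: cyc_nat.
by apply: cyc_dvd cj; rewrite dvdn_mull.
Qed.

Lemma cyc_Qab n x : (0 < n)%N -> cyc n x -> Qab x.
Proof. by move=> n0 /cyc_inQcyc; exists n. Qed.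

Lemma Qab0 : Qab 0.
Proof. by apply: (@cyc_Qab 1) => //; apply: cyc0. Qed.

Lemma Qab1 : Qab 1.
Proof. by apply: (@cyc_Qab 1) => //; apply: cyc1. Qed.

Lemma Qab_common2 x y : Qab x -> Qab y ->
  exists n d, [/\ (0 < n)%N, (0 < d)%N, cyc n (d%:R * x) & cyc n (d%:R * y)].
Proof.
move=> Qx Qy; have [|n [d [n0 d0 H]]] := @Qab_common _ (fun b : bool => if b then x else y).
  by case.
by exists n, d; split=> //; [apply: (H true) | apply: (H false)].
Qed.

Lemma QabM x y : Qab x -> Qab y -> Qab (x * y).
Proof.
move=> /Qab_common2 H /H [n [d [n0 d0 cx cy]]]; exists n => //; exists (d * d)%N.
  by rewrite muln_gt0 d0.
by rewrite natrM mulrACA; apply: cycM.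
Qed.

Lemma QabN x : Qab x -> Qab (- x).
Proof.
by move=> [n n0 [d d0 cx]]; exists n => //; exists d => //; rewrite mulrN; apply: cycN.
Qed.

(** The inverse is the product of the other conjugates divided by the norm, a nonzero integer. *)
Lemma cycV n x : (0 < n)%N -> cyc n x -> x != 0 -> Qab x^-1.
Proof.
move=> n0 cx x0; pose k1 := Ordinal (ltn_pmod 1 n0).
have E1 : tau n k1 x = x.
  apply: (aut_cyc_eq (mu := idfun)) cx => z zn /=.
  by rewrite tauE ?coprime_modl ?coprime1n // expr_mod.
have := cyc_norm_int n0 cx; rewrite (bigD1 k1) /=; last by rewrite coprime_modl coprime1n.
rewrite E1; set y := \prod_(i < n | _) _ => /intrP [a Ea].
have cy : cyc n y by apply: cyc_prod => k _; apply: cyc_aut.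
have y0 : y != 0 by apply/prodf_neq0 => k _; rewrite fmorph_eq0.
exists n => //; exists `|a|%N.
  rewrite absz_gt0; apply: contra_neq (mulf_neq0 x0 y0); rewrite Ea => ->; exact: mulr0z.
have -> : `|a|%N%:R = (sgz a)%:~R * a%:~R :> algC.
  by rewrite -intrM -abszEsg.
rewrite -Ea -mulrA; apply: cycM; first exact: cyc_int.
by rewrite mulrAC divff // mul1r.
Qed.

Lemma QabV x : Qab x -> x != 0 -> Qab x^-1.
Proof.
move=> [n n0 [d d0 cx]] x0.
have dn0 : d%:R != 0 :> algC by rewrite pnatr_eq0 -lt0n.
have -> : x^-1 = d%:R * (d%:R * x)^-1 by rewrite invfM mulrA divff // mul1r.
apply: QabM; first by apply: (cyc_Qab n0); apply: cyc_nat.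
by apply: (cycV n0 cx); rewrite mulf_neq0.
Qed.

Lemma Qab_basis (s : seq algC) : exists b : seq algC,
  (forall c : nat -> algC, (forall j, Qab (c j)) -> \sum_(j < size b) c j * b`_j = 0 ->
     forall j, (j < size b)%N -> c j = 0) /\
  (forall x, x \in s -> exists c : nat -> algC, (forall j, Qab (c j)) /\
     x = \sum_(j < size b) c j * b`_j).
Proof.
elim: s => [|x s [b [free span]]].
  by exists [::]; split=> //.
have [[c [Qc Ex]]|nspan] := classic (exists c : nat -> algC, (forall j, Qab (c j)) /\
     x = \sum_(j < size b) c j * b`_j).
  by exists b; split=> // z; rewrite inE => /orP [/eqP ->|/span //]; exists c.
exists (x :: b); split=> /= [c Qc|z].
  rewrite big_ord_recl /= => E.
  have c0 : c 0%N = 0.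
    apply/eqP/negPn/negP => c0; apply: nspan.
    exists (fun j => - (c 0%N)^-1 * c j.+1); split.
      by move=> j; apply: QabM => //; apply: QabN; apply: QabV.
    under eq_bigr do rewrite -mulrA.
    rewrite -mulr_sumr; apply: (mulfI c0); rewrite mulrA mulrN divff // mulN1r.
    by apply/eqP; rewrite -addr_eq0; apply/eqP.
  move=> [|j] // jb; apply: (free (fun j => c j.+1)) => //.
  by rewrite -[RHS]E c0 mul0r add0r.
rewrite inE => /orP [/eqP ->|/span [c [Qc ->]]].
  exists (fun j => (j == 0%N)%:R); split; first by case=> [|j]; [apply: Qab1 | apply: Qab0].
  by rewrite big_ord_recl /= mul1r big1 ?addr0 // => i _; rewrite mul0r.
exists (fun j => if j is i.+1 then c i else 0); split; first by case=> [|j] //; apply: Qab0.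
by rewrite big_ord_recl /= mul0r add0r.
Qed.

(** In a basis of the span of the a i over [Qab], every coordinate of the sum vanishes; with
    denominators cleared, each is an integer combination of roots of unity and [mann_cosets]
    applies. W depends on a alone, not on rho. *)
Theorem vanishing_sum_cosets (k : nat) (a : 'I_k -> algC) : exists2 W, (0 < W)%N &
  forall rho : 'I_k -> algC, (forall i, runity (rho i)) -> \sum_i a i * rho i = 0 ->
  forall r, r != 0 -> \sum_(i | (rho i / r) ^+ W == 1) a i * rho i = 0.
Proof.
have [b [free span]] := Qab_basis [seq a i | i <- enum 'I_k].
set e := size b in free span.
have /fin_all_exists [g Hg] (i : 'I_k) : exists c : nat -> algC, (forall j, Qab (c j)) /\
     a i = \sum_(j < e) c j * b`_j.
  by apply: span; apply: map_f; rewrite mem_enum.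
have [|n [d [n0 d0 Hd]]] := @Qab_common _ (fun ij : 'I_k * 'I_e => g ij.1 ij.2).
  by case=> i j; have [Qg _] := Hg i; apply: Qg.
have dn0 : d%:R != 0 :> algC by rewrite pnatr_eq0 -lt0n.
have /fin_all_exists [sg Hsg] (ij : 'I_k * 'I_e) := Hd ij.
pose size_j (j : 'I_e) := size (flatten [seq sg (i, j) | i <- enum 'I_k]).
pose B := \max_j size_j j.
(* B bounds the number of terms in a coordinate; the factor n absorbs the n-th roots coming from the
   coefficients, which then do not affect the class of [rho i]. *)
exists (n * B`!)%N; first by rewrite muln_gt0 n0 fact_gt0.
move=> rho urho E r r0; set W := (n * B`!)%N.
have sumE (Q : pred 'I_k) : \sum_(i | Q i) a i * rho i =
    \sum_(j < e) (\sum_(i | Q i) g i j * rho i) * b`_j.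
  under eq_bigr => i _ do rewrite (Hg i).2 mulr_suml.
  rewrite exchange_big; apply: eq_bigr => j _; rewrite mulr_suml; apply: eq_bigr => i _.
  by rewrite mulrAC.
have Qrho i : Qab (rho i).
  by have [l l0 rl] := urho i; apply: (cyc_Qab l0); apply: cyc_root.
have col0 (j : 'I_e) : \sum_i g i j * rho i = 0.
  apply: (free (fun j => \sum_i g i j * rho i)) => //; last by rewrite -sumE.
  move=> l; apply: big_ind => [|x y|i _]; first exact: Qab0.
    move=> /Qab_common2 H /H [n' [d' [n'0 d'0 cx cy]]]; exists n' => //; exists d' => //.
    by rewrite mulrDr; apply: cycD.
  by apply: QabM => //; have [Qg _] := Hg i.
rewrite sumE big1 // => j _; suff -> : \sum_(i | (rho i / r) ^+ W == 1) g i j * rho i = 0.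
  by rewrite mul0r.
pose S := flatten [seq [seq (t.1, t.2 * rho i) | t <- sg (i, j)] | i <- enum 'I_k].
have SE (Q : pred 'I_k) (P : pred (int * algC)) :
    (forall i t, t \in sg (i, j) -> P (t.1, t.2 * rho i) = Q i) ->
    \sum_(t <- S | P t) t.1%:~R * t.2 = d%:R * \sum_(i | Q i) g i j * rho i.
  move=> PQ; rewrite big_flatten /= big_map big_enum mulr_sumr [RHS]big_mkcond /=.
  apply: eq_bigr => i _; rewrite big_map /=; case: ifP => Qi.
    rewrite mulrA (Hsg (i, j)).2 mulr_suml big_seq_cond [RHS]big_seq.
    by apply: eq_big => [t|t _]; [case ts: (t \in _) => //=; rewrite PQ | rewrite mulrA].
  by rewrite big_seq_cond big_pred0 // => t; case ts: (t \in _) => //=; rewrite PQ.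
apply: (mulfI dn0); rewrite mulr0 -(SE _ (fun t => (t.2 / r) ^+ W == 1)).
  apply: (@mann_cosets B) => //; first by rewrite dvdn_mull.
  - move=> u /flatten_mapP [i _ /mapP [t ts ->]] /=; apply: runityM => //.
    by exists n => //; apply/eqP; apply: (allP (Hsg (i, j)).1).
  - have -> : size S = size_j j.
      rewrite /size_j /S !size_flatten /shape -!map_comp; congr sumn; apply: eq_map => i /=.
      by rewrite size_map.
    exact: leq_bigmax.
  - by rewrite (SE xpredT) // col0 mulr0.
move=> i t ts /=; congr (_ == _).
have tW : t.2 ^+ W = 1.
  by rewrite exprM (eqP (allP (Hsg (i, j)).1 _ ts)) expr1n.
by rewrite -mulrA exprMn tW mul1r.
Qed.

(** * Loxton's theorem over K^c *)

Lemma Aint_multiple (w : algC) : exists2 d : nat, (0 < d)%N & d%:R * w \in Aint.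
Proof.
have [p [Dp mp] _] := minCpolyP w.
have [q [a a0 Eq]] := rat_poly_scale p.
have szq : size q = size p.
  rewrite Eq size_scale ?invr_eq0 ?intr_eq0 // size_map_inj_poly //; exact: intr_inj.
have sp : (1 < size p)%N.
  by have := size_minCpoly w; rewrite Dp size_map_poly.
pose n := (size p).-1; have Dn : size p = n.+1 by rewrite prednK // ltnW.
have n0 : (0 < n)%N by move: sp; rewrite Dn.
have an0 : a%:~R != 0 :> rat by rewrite intr_eq0.
have qn : q`_n = a.
  have : lead_coef p = 1 by apply/eqP.
  rewrite Eq lead_coefZ lead_coef_map_inj //; last exact: intr_inj.
  rewrite /lead_coef szq Dn /= => /(canRL (mulVKf an0)); rewrite mulr1 => /intr_inj //.
have qw : \sum_(i < n.+1) (q`_i)%:~R * w ^+ i = 0 :> algC.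
  have : root (minCpoly w) w by apply: root_minCpoly.
  rewrite Dp Eq map_polyZ rootZ ?fmorph_eq0 ?invr_eq0 // => /rootP.
  rewrite -map_poly_comp horner_coef size_map_inj_poly ?szq ?Dn //.
  - move=> E; rewrite -[RHS]E; apply: eq_bigr => i _; rewrite coef_map_id0 /= ?ratr_int //.
  - by move=> u v /= /(fmorph_inj _) /intr_inj.
  - by rewrite /= mulr0z raddf0.
(* With a the leading coefficient of q, these are the coefficients of a^(n-1) q(X / a), which is
   monic and has the root a w. *)
pose r (i : nat) : int := if i == n then 1 else q`_i * a ^+ (n.-1 - i).
pose R : {poly int} := \poly_(i < n.+1) r i.
have sR : size R = n.+1 by apply: size_poly_eq; rewrite /r eqxx.
have mR : R \is monic by rewrite monicE lead_coefE sR coef_poly ltnSn /r eqxx.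
have Aw : a%:~R * w \in Aint.
  apply: (@root_monic_Aint (map_poly intr R)).
  - apply/rootP; rewrite horner_coef size_map_inj_poly ?sR //; last exact: intr_inj.
    transitivity (a%:~R ^+ n.-1 * \sum_(i < n.+1) (q`_i)%:~R * w ^+ i); last by rewrite qw mulr0.
    rewrite mulr_sumr; apply: eq_bigr => i _.
    rewrite coef_map_id0 // coef_poly ltn_ord /r exprMn.
    have [->|ni] := eqVneq (i : nat) n.
      by rewrite qn mul1r mulrA -exprSr prednK.
    have le : (i <= n.-1)%N by have := ltn_ord i; move: ni; lia.
    by rewrite rmorphM rmorphXn /= -[in RHS](subnK le) exprD; ring.
  - exact: monic_map.
  - by apply/polyOverP => i; rewrite coef_map_id0 // intr_int.
exists `|a|%N; first by rewrite absz_gt0.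
have -> : `|a|%N%:R = (sgz a)%:~R * a%:~R :> algC by rewrite -intrM -abszEsg.
by rewrite -mulrA rpredM // Aint_int.
Qed.

Lemma norm_bound_seq (s : seq algC) : exists b : nat, forall r, r \in s -> `|r| <= b%:R.
Proof.
elim: s => [|r s [b Hb]]; first by exists 0%N.
exists (b + Num.bound `|r|)%N => u; rewrite inE => /orP [/eqP ->|/Hb le].
  apply: le_trans (ltW (archi_boundP (normr_ge0 r))) _.
  by rewrite ler_nat leq_addl.
by apply: le_trans le _; rewrite ler_nat leq_addr.
Qed.

Lemma conjugate_bound (w : algC) : exists b : nat,
  forall nu : {rmorphism algC -> algC}, `|nu w| <= b%:R.
Proof.
have [rs Drs] := minCpoly_splits w; have [b Hb] := norm_bound_seq rs.
exists b => nu; apply: Hb; rewrite -root_prod_XsubC -Drs -(minCpoly_aut nu).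
exact: root_minCpoly.
Qed.

Lemma Aint_multiple_fin (I : finType) (f : I -> algC) :
  exists2 d : nat, (0 < d)%N & forall i, d%:R * f i \in Aint.
Proof.
suff [d d0 Hd] : exists2 d : nat, (0 < d)%N & forall i, i \in enum I -> d%:R * f i \in Aint.
  by exists d => // i; apply: Hd; rewrite mem_enum.
elim: (enum I) => [|i s [d d0 Hd]]; first by exists 1%N.
have [e e0 He] := Aint_multiple (f i).
exists (d * e)%N; first by rewrite muln_gt0 d0.
move=> j; rewrite inE => /orP [/eqP ->|/Hd Aj].
  by rewrite natrM -mulrA rpredM // Aint_Cnat.
by rewrite natrM mulrAC rpredM // Aint_Cnat.
Qed.

Lemma conjugate_bound_fin (I : finType) (f : I -> algC) :
  exists b : nat, forall i (nu : {rmorphism algC -> algC}), `|nu (f i)| <= b%:R.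
Proof.
have /fin_all_exists [b Hb] i := conjugate_bound (f i).
exists (\max_i b i) => i nu; apply: le_trans (Hb i nu) _.
by rewrite ler_nat leq_bigmax.
Qed.

Lemma inQcycD n x y : inQcyc n x -> inQcyc n y -> inQcyc n (x + y).
Proof.
move=> [d d0 cx] [e e0 cy]; exists (d * e)%N; first by rewrite muln_gt0 d0.
rewrite natrM mulrDr; apply: cycD.
  by rewrite mulrAC mulrC; apply: cycM cx; apply: cyc_nat.
by rewrite -mulrA; apply: cycM cy; apply: cyc_nat.
Qed.

Lemma inQcyc_rat n (a : rat) : inQcyc n (ratr a).
Proof.
exists `|denq a|%N; first by rewrite absz_gt0 denq_neq0.
have -> : `|denq a|%N%:R = ratr (denq a)%:~R :> algC.
  by rewrite ratr_int pmulrn absz_denq.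
by rewrite -rmorphM /= mulrC -numqE ratr_int; apply: cyc_int.
Qed.

Lemma inK_inQcyc n z x : z ^+ n = 1 -> inK z x -> inQcyc n x.
Proof.
move=> zn [q ->]; rewrite horner_coef; apply: big_ind.
- by apply: cyc_inQcyc; apply: cyc0.
- by move=> u v; apply: inQcycD.
- move=> i _; apply: inQcycM; last by apply: cyc_root; rewrite exprAC zn expr1n.
  by rewrite coef_map; apply: inQcyc_rat.
Qed.

(** Exchanges theta and z in the tower, so that the conjugates over Q(z) are among the finitely many
    of the fixed theta. *)
Lemma inKc_poly theta x : inKc theta x -> exists n z (p : {poly algC}),
  [/\ (0 < n)%N, z ^+ n = 1, forall i, inK z p`_i & x = p.[theta]].
Proof.
move=> [n [z [n0 [zn [p [Kp ->]]]]]].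
have /fin_all_exists [g Hg] (i : 'I_(size p)) :
    exists q : {poly rat}, p`_i = (map_poly ratr q).[theta] by exact: Kp.
exists n, z, (\sum_(i < size p) (z ^+ i) *: map_poly ratr (g i)); split=> //.
  move=> l; exists (\sum_(i < size p) (g i)`_l *: 'X^i).
  rewrite coef_sum rmorph_sum horner_sum; apply: eq_bigr => i _ /=.
  by rewrite coefZ coef_map map_polyZ map_polyXn hornerZ hornerXn mulrC.
rewrite horner_coef horner_sum; apply: eq_bigr => i _.
by rewrite hornerZ Hg mulrC.
Qed.

Lemma unity_comb_scale B (E E' : seq algC) t x : (forall e, e \in E -> t * e \in E') ->
  unity_comb B E x -> unity_comb B E' (t * x).
Proof.
move=> HE [s [Hs H1 ->]]; exists [seq (t * u.1, u.2) | u <- s]; split.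
- by rewrite size_map.
- by move=> _ /mapP [u /H1 [uE ur] ->]; split=> //; apply: HE.
- by rewrite big_map mulr_sumr; apply: eq_bigr => u _ /=; rewrite mulrA.
Qed.

Definition lagrange (k : nat) (T : 'I_k -> algC) (A : {set 'I_k}) (i : 'I_k) : {poly algC} :=
  (\prod_(j in A :\ i) (T i - T j))^-1 *: \prod_(j in A :\ i) ('X - (T j)%:P).

Lemma lagrange_interpolation k (T : 'I_k -> algC) (A : {set 'I_k}) (q : {poly algC}) :
  injective T -> (size q <= #|A|)%N ->
  q = \sum_(i in A) q.[T i] *: lagrange T A i.
Proof.
move=> injT szq; apply/eqP; rewrite -subr_eq0; apply/eqP.
pose s := [seq T i | i <- enum A].
apply: (@roots_geq_poly_eq0 _ _ s).
- apply/allP => u /mapP [l]; rewrite mem_enum => lA ->.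
  rewrite /root hornerD hornerN horner_sum (bigD1 l) //= [X in - (_ + X)]big1.
    rewrite addr0 hornerZ /lagrange hornerZ horner_prod.
    under [X in _^-1 * X]eq_bigr do rewrite hornerXsubC.
    rewrite mulVf ?mulr1 ?subrr //; apply/prodf_neq0 => j.
    by rewrite !inE subr_eq0 => /andP [jl _]; rewrite (inj_eq injT) eq_sym.
  move=> i /andP [iA il]; rewrite hornerZ /lagrange hornerZ horner_prod.
  rewrite [X in _ * (_ * X)](bigD1 l) /=; last by rewrite !inE lA andbT eq_sym.
  by rewrite hornerXsubC subrr mul0r !mulr0.
- by rewrite map_inj_uniq // enum_uniq.
- rewrite size_map -cardE; apply: leq_trans (size_polyD _ _) _.
  rewrite geq_max szq size_polyN; apply: leq_trans (size_sum _ _ _) _.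
  apply/bigmax_leqP => i iA; apply: leq_trans (size_scale_leq _ _) _.
  apply: leq_trans (size_scale_leq _ _) _.
  by rewrite -big_enum size_prod_XsubC -cardE (cardsD1 i A) iA.
Qed.

(* The coefficients of x as a polynomial in theta over Q(z) are given by Lagrange
   interpolation at the conjugates of theta over Q(z), which form a subset A of
   the finitely many conjugates over Q: their denominators and conjugates are
   bounded independently of z. *)
Theorem loxton_Kc (theta : algC) (c : nat) : exists B E, forall x, inOKc theta x ->
  (forall nu : {rmorphism algC -> algC}, `|nu x| <= c%:R) -> unity_comb B E x.
Proof.
have [rs0 Drs0] := minCpoly_splits theta.
pose Th := undup rs0; pose k := size Th; pose T (i : 'I_k) := Th`_i.
have injT : injective T.
  by move=> i j /eqP; rewrite nth_uniq ?undup_uniq // => /eqP /val_inj.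
pose w (t : {set 'I_k} * 'I_k * 'I_k) := (lagrange T t.1.1 t.1.2)`_t.2.
have [D D0 HD] := Aint_multiple_fin w.
have [b Hb] := conjugate_bound_fin (fun t => D%:R * w t).
(* A conjugate of D q_l is a sum of at most k products of a conjugate of x, bounded by c, and a
   conjugate of a constant D w, bounded by b. *)
pose C := ((k * (c * b)) ^ 2)%N.
have [B [E HE]] := loxton_cyclotomic C.
exists (k * B)%N, [seq D%:R^-1 * theta ^+ (l : 'I_k) * e | l <- enum 'I_k, e <- E].
move=> x [/inKc_poly [n [z [p [n0 zn Kp Dx]]]] Ax] xc.
have Dn0 : D%:R != 0 :> algC by rewrite pnatr_eq0 -lt0n.
have [rs [urs rsT rsnu /(_ p Kp) [q [Kq szq Eq]]]] := relative_conjugates z theta.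
pose A := [set i | T i \in rs].
have rsE : rs =i [seq T i | i in A].
  move=> r; apply/idP/imageP => [rrs|[i]]; last by rewrite inE => ? ->.
  have : r \in Th by rewrite mem_undup -root_prod_XsubC -Drs0; apply: rsT.
  move=> rTh; have rk : (index r Th < k)%N by rewrite index_mem.
  by exists (Ordinal rk); rewrite ?inE /T /= nth_index.
have szA : size rs = #|A|.
  rewrite -(size_image T A); apply/eqP; rewrite -uniq_size_uniq //.
  by rewrite map_inj_uniq // enum_uniq.
rewrite szA in szq; have Eqi := lagrange_interpolation injT szq.
(* An automorphism that fixes z fixes the coefficients of q; if it moves theta to [T i], it moves x
   to the value of q there. *)
have conj i : exists nu : {rmorphism algC -> algC}, i \in A -> q.[T i] = nu x.
  have [iA|] := boolP (i \in A); last by exists idfun.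
  have [|nu [nuz nuth]] := rsnu (T i); first by move: iA; rewrite inE.
  exists nu => _; rewrite Dx Eq; have -> : nu q.[theta] = (map_poly nu q).[nu theta] by rewrite horner_map.
  rewrite nuth; congr (_.[_]).
  apply/polyP => j; rewrite coef_map; have [g ->] := Kq j.
  have Enu : nu (map_poly ratr g).[z] = (map_poly nu (map_poly ratr g)).[nu z].
    by rewrite horner_map.
  rewrite [RHS]Enu nuz -map_poly_comp; congr (_.[_]).
  by apply: eq_map_poly => a /=; rewrite fmorph_rat.
have /fin_all_exists [nu Hnu] := conj.
have coefE (l : 'I_k) : D%:R * q`_l = \sum_(i in A) nu i x * (D%:R * w (A, i, l)).
  rewrite [in LHS]Eqi coef_sum mulr_sumr; apply: eq_bigr => i iA.
  by rewrite coefZ -Hnu // mulrCA.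
have comb (l : 'I_k) : unity_comb B E (D%:R * q`_l).
  apply: (HE n) => //.
    apply: Aint_inQcyc => //.
      by rewrite coefE rpred_sum // => i _; rewrite rpredM // Aint_aut.
    by rewrite mulrC; apply: inQcycM (cyc_nat _ _); apply: inK_inQcyc (Kq l).
  rewrite /energy mulnC natrM -card_coprime [X in _ <= X]mulr_natl.
  rewrite -(sumr_const [pred j : 'I_n | coprime j n] (C%:R : algC)).
  rewrite [X in _ <= X](eq_bigl (fun j : 'I_n => coprime j n)); last by move=> j; rewrite inE.
  apply: ler_sum => j _; rewrite /C natrX; apply: lerXn2r; rewrite ?nnegrE ?ler0n //.
  rewrite coefE rmorph_sum; apply: le_trans (ler_norm_sum _ _ _) _.
  apply: le_trans (_ : \sum_(i in A) (c * b)%:R <= _); last first.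
    rewrite sumr_const -mulrnA ler_nat mulnC leq_mul2r; apply/orP; right.
    by rewrite -[X in (_ <= X)%N](card_ord k) max_card.
  apply: ler_sum => i _; rewrite rmorphM normrM natrM ler_pM //.
  exact: (xc (tau n j \o nu i)).
rewrite Dx Eq.
have -> : q.[theta] = \sum_(l < k) D%:R^-1 * theta ^+ l * (D%:R * q`_l).
  rewrite (@horner_coef_wide _ k); last first.
    by apply: leq_trans szq _; rewrite -[X in (_ <= X)%N](card_ord k) max_card.
  by apply: eq_bigr => l _; rewrite mulrACA mulVf // mul1r mulrC.
have := @unity_comb_sum _ [pred l : 'I_k | true] B
  [seq D%:R^-1 * theta ^+ (l : 'I_k) * e | l <- enum 'I_k, e <- E]
  (fun l : 'I_k => D%:R^-1 * theta ^+ l * (D%:R * q`_l)).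
rewrite (eq_card (_ : _ =i 'I_k)) // card_ord; apply => l _.
apply: unity_comb_scale (comb l) => e eE.
by apply: allpairs_f => //; rewrite mem_enum.
Qed.

(** * Laurent polynomials on the torus *)

Definition mon (n r : nat) (u : 'M[int]_(n, r)) (t : point r) : point n :=
  fun i => \prod_(j < r) t j ^ u i j.

Definition chr (r : nat) (m : 'rV[int]_r) (t : point r) : algC := mon m t 0.

Definition pmul (n : nat) (s t : point n) : point n := fun i => s i * t i.

Lemma mon_torus n r (u : 'M_(n, r)) t : in_torus t -> in_torus (mon u t).
Proof. by move=> Ht i; apply/prodf_neq0 => j _; rewrite expfz_neq0. Qed.

Lemma pmul_torus n (s t : point n) : in_torus s -> in_torus t -> in_torus (pmul s t).
Proof. by move=> Hs Ht i; rewrite mulf_neq0. Qed.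

Lemma chr_neq0 r (m : 'rV_r) t : in_torus t -> chr m t != 0.
Proof. by move=> Ht; apply: mon_torus. Qed.

Lemma mon_pmul n r (u : 'M_(n, r)) s t : mon u (pmul s t) = pmul (mon u s) (mon u t).
Proof.
apply: functional_extensionality => i; rewrite /mon /pmul -big_split /=.
by apply: eq_bigr => j _; rewrite expfzMl.
Qed.

Lemma mon_comp n r q (u : 'M_(n, r)) (v : 'M_(r, q)) t : in_torus t ->
  mon u (mon v t) = mon (u *m v) t.
Proof.
move=> Ht; apply: functional_extensionality => i; rewrite /mon.
have prodz (a : int) (f : 'I_q -> algC) : (\prod_j f j) ^ a = \prod_j f j ^ a.
  by apply: (big_morph (fun x => x ^ a)) => [x y|]; rewrite ?expfzMl ?exp1rz.
transitivity (\prod_(j < q) \prod_(l < r) t j ^ (u i l * v l j)).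
  rewrite exchange_big; apply: eq_bigr => l _; rewrite prodz; apply: eq_bigr => j _.
  by rewrite exprz_exp mulrC.
apply: eq_bigr => j _; rewrite mxE.
by symmetry; apply: (big_morph (fun a => t j ^ a)) => [a b|]; rewrite ?expfzDr.
Qed.

Lemma mon1 n (t : point n) : mon 1%:M t = t.
Proof.
apply: functional_extensionality => i; rewrite /mon (bigD1 i) //= mxE eqxx expr1z.
by rewrite big1 ?mulr1 // => j /negbTE ji; rewrite mxE eq_sym ji expr0z.
Qed.

Lemma chr_mon n r (m : 'rV_n) (u : 'M_(n, r)) t : in_torus t ->
  chr m (mon u t) = chr (m *m u) t.
Proof. by move=> Ht; rewrite /chr mon_comp. Qed.

Lemma mon_row n r (u : 'M_(n, r)) t i : mon u t i = chr (row i u) t.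
Proof. by apply: eq_bigr => j _; rewrite mxE. Qed.

Lemma chr_pmul r (m : 'rV_r) s t : chr m (pmul s t) = chr m s * chr m t.
Proof. by rewrite /chr mon_pmul. Qed.

Lemma chrD r (m p : 'rV_r) t : in_torus t -> chr (m + p) t = chr m t * chr p t.
Proof.
move=> Ht; rewrite /chr /mon -big_split /=; apply: eq_bigr => j _.
by rewrite mxE expfzDr.
Qed.

Lemma chr0 r (t : point r) : chr 0 t = 1.
Proof. by rewrite /chr /mon big1 // => j _; rewrite mxE expr0z. Qed.

Lemma chrB r (m p : 'rV_r) t : in_torus t -> chr (m - p) t = chr m t / chr p t.
Proof.
move=> Ht; apply: (mulIf (chr_neq0 p Ht)).
by rewrite -chrD // subrK divfK // chr_neq0.
Qed.

Definition torsion (n : nat) (t : point n) := forall i, runity (t i).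

Lemma torsion_torus n (t : point n) : torsion t -> in_torus t.
Proof. by move=> Ht i; apply: runity_neq0. Qed.

Lemma runity_expz z (a : int) : runity z -> runity (z ^ a).
Proof.
by case: a => a uz; rewrite ?NegzE /exprz; [apply: runityX | apply: runityV; apply: runityX].
Qed.

Lemma mon_torsion n r (u : 'M_(n, r)) t : torsion t -> torsion (mon u t).
Proof.
move=> Ht i; apply: big_ind => [|x y|j _]; [exact: runity1 | exact: runityM |].
exact: runity_expz.
Qed.

Lemma pmul_torsion n (s t : point n) : torsion s -> torsion t -> torsion (pmul s t).
Proof. by move=> Hs Ht i; apply: runityM. Qed.

Definition laurent_val (r : nat) (s : seq (algC * 'rV[int]_r)) (t : point r) : algC :=
  \sum_(x <- s) x.1 * chr x.2 t.

Definition laurent (r : nat) (g : point r -> algC) :=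
  exists s, forall t, in_torus t -> g t = laurent_val s t.

Lemma laurent_ext r (g h : point r -> algC) : (forall t, in_torus t -> g t = h t) ->
  laurent h -> laurent g.
Proof. by move=> E [s Hs]; exists s => t Ht; rewrite E // Hs. Qed.

Lemma laurent_monom r (a : algC) (m : 'rV_r) : laurent (fun t => a * chr m t).
Proof. by exists [:: (a, m)] => t _; rewrite /laurent_val big_seq1. Qed.

Lemma laurent_const r (a : algC) : laurent (fun _ : point r => a).
Proof.
by apply: laurent_ext (laurent_monom a 0) => t _; rewrite chr0 mulr1.
Qed.

Lemma laurentD r (g h : point r -> algC) : laurent g -> laurent h -> laurent (fun t => g t + h t).
Proof.
move=> [s Hs] [s' Hs']; exists (s ++ s') => t Ht.
by rewrite Hs // Hs' // /laurent_val big_cat.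
Qed.

Lemma laurent_sum r (I : Type) (l : seq I) (Q : pred I) (g : I -> point r -> algC) :
  (forall i, laurent (g i)) -> laurent (fun t => \sum_(i <- l | Q i) g i t).
Proof.
move=> H; elim: l => [|i l IH].
  by apply: laurent_ext (@laurent_const r 0) => t _; rewrite big_nil.
case Qi: (Q i).
  by apply: laurent_ext (laurentD (H i) IH) => t _; rewrite big_cons Qi.
by apply: laurent_ext IH => t _; rewrite big_cons Qi.
Qed.

Lemma laurentM r (g h : point r -> algC) : laurent g -> laurent h -> laurent (fun t => g t * h t).
Proof.
move=> [s Hs] [s' Hs'].
apply: (@laurent_ext _ _ (fun t => \sum_(x <- s) \sum_(y <- s') (x.1 * y.1) * chr (x.2 + y.2) t)).
  move=> t Ht; rewrite Hs // Hs' // /laurent_val mulr_suml; apply: eq_bigr => x _.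
  by rewrite mulr_sumr; apply: eq_bigr => y _; rewrite chrD // mulrACA.
apply: laurent_sum => x; apply: laurent_sum => y; exact: laurent_monom.
Qed.

Lemma laurent_prod r (I : Type) (l : seq I) (Q : pred I) (g : I -> point r -> algC) :
  (forall i, laurent (g i)) -> laurent (fun t => \prod_(i <- l | Q i) g i t).
Proof.
move=> H; elim: l => [|i l IH].
  by apply: laurent_ext (@laurent_const r 1) => t _; rewrite big_nil.
case Qi: (Q i).
  by apply: laurent_ext (laurentM (H i) IH) => t _; rewrite big_cons Qi.
by apply: laurent_ext IH => t _; rewrite big_cons Qi.
Qed.

Lemma laurentX r (g : point r -> algC) k : laurent g -> laurent (fun t => g t ^+ k).
Proof.
move=> Hg; elim: k => [|k IH]; first exact: laurent_const.
by apply: laurent_ext (laurentM Hg IH) => t _; rewrite exprS.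
Qed.

Lemma laurent_meval r n (p : {mpoly algC[n]}) (g : point r -> point n) :
  (forall k, laurent (fun t => g t k)) -> laurent (fun t => p.@[g t]).
Proof.
move=> H; apply: (@laurent_ext _ _
  (fun t => \sum_(m <- msupp p) p@_m * \prod_i g t i ^+ m i)).
  by move=> t _; rewrite mevalE.
apply: laurent_sum => m; apply: laurentM; first exact: laurent_const.
by apply: laurent_prod => i; apply: laurentX.
Qed.

Lemma laurent_subst r n (g : point n -> algC) (c : point n) (u : 'M_(n, r)) :
  in_torus c -> laurent g -> laurent (fun t => g (pmul c (mon u t))).
Proof.
move=> Hc [s Hs]; exists [seq (x.1 * chr x.2 c, x.2 *m u) | x <- s] => t Ht.
rewrite Hs; last by apply: pmul_torus => //; apply: mon_torus.
rewrite /laurent_val big_map; apply: eq_bigr => x _ /=.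
by rewrite chr_pmul chr_mon // mulrA.
Qed.

Lemma poly_nonroot (p : {poly algC}) : p != 0 -> exists s, p.[s] != 0.
Proof.
move=> p0; pose l := [seq i%:R : algC | i <- iota 0 (size p)].
have : ~~ all (root p) l.
  apply/negP => al; have := max_poly_roots p0 al.
  rewrite map_inj_uniq ?iota_uniq ?size_map ?size_iota ?ltnn; last first.
    by move=> i j /eqP; rewrite eqr_nat => /eqP.
  by move=> /(_ isT).
by move=> /allPn [s _ ps]; exists s.
Qed.

Lemma laurent_line r (g : point r -> algC) (q : 'I_r -> {poly algC}) : laurent g ->
  exists (G : {poly algC}) (e : nat), forall s, in_torus (fun i => (q i).[s]) ->
    G.[s] = (\prod_i (q i).[s]) ^+ e * g (fun i => (q i).[s]).
Proof.
move=> [l Hl]; suff [G [e HG]] : exists (G : {poly algC}) (e : nat),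
    forall s, in_torus (fun i => (q i).[s]) ->
    G.[s] = (\prod_i (q i).[s]) ^+ e * laurent_val l (fun i => (q i).[s]).
  by exists G, e => s Hs; rewrite HG // Hl.
elim: l {Hl} => [|[a m] l [G [e HG]]].
  by exists 0, 0%N => s _; rewrite /laurent_val big_nil mulr0 horner0.
pose K := (\sum_j `|m 0%R j|)%N.
exists (G * (\prod_i q i) ^+ K + a *: (\prod_i q i ^+ absz (K%:Z + m 0 i)%R) * (\prod_i q i) ^+ e), (e + K)%N.
move=> s Hs; rewrite /laurent_val big_cons /= -/(laurent_val l _).
rewrite hornerD hornerM HG // hornerM hornerZ !horner_exp !horner_prod exprD.
set v := fun i => (q i).[s]; set Pi := \prod_i (q i).[s].
suff -> : \prod_i (q i ^+ absz (K%:Z + m 0 i)%R).[s] = Pi ^+ K * chr m v by ring.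
rewrite /Pi -prodrXl /chr /mon -big_split /=; apply: eq_bigr => i _.
rewrite horner_exp -[X in X * _]/(v i ^ K%:Z) -expfzDr; last exact: Hs.
have : 0 <= K%:Z + m 0 i.
  have : (`|m 0%R i| <= K)%N by rewrite /K (bigD1 i) //= leq_addr.
  by lia.
by case: (K%:Z + m 0 i).
Qed.

Lemma not_zero_on_torus r (g : point r -> algC) :
  ~ (forall t, in_torus t -> g t = 0) -> exists2 t, in_torus t & g t != 0.
Proof.
move=> H; apply: NNPP => nex; apply: H => t Ht; apply: NNPP => /eqP gt.
by apply: nex; exists t.
Qed.

(* Restriction to the line through two points of the torus reduces the claim to
   polynomials in one variable. *)
Lemma laurent_mul_eq0 r (g h : point r -> algC) : laurent g -> laurent h ->
  (forall t, in_torus t -> g t * h t = 0) ->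
  (forall t, in_torus t -> g t = 0) \/ (forall t, in_torus t -> h t = 0).
Proof.
move=> Lg Lh gh; apply: NNPP => /not_or_and [ng nh].
have [t1 T1 g1] := not_zero_on_torus ng; have [t2 T2 h2] := not_zero_on_torus nh.
pose q i : {poly algC} := (t1 i)%:P + (t2 i - t1 i) *: 'X.
have q0 : (fun i => (q i).[0]) = t1.
  apply: functional_extensionality => i.
  by rewrite /q hornerD hornerC hornerZ hornerX mulr0 addr0.
have q1 : (fun i => (q i).[1]) = t2.
  apply: functional_extensionality => i.
  by rewrite /q hornerD hornerC hornerZ hornerX mulr1 addrC subrK.
have [G [e HG]] := laurent_line q Lg; have [H [f HH]] := laurent_line q Lh.
have prodT (t : point r) : in_torus t -> \prod_i t i != 0.
  by move=> Ht; apply/prodf_neq0.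
have nG : G != 0.
  apply: contra_neq (_ : G.[0] != 0) => [->|]; first by rewrite horner0.
  rewrite HG q0 // mulf_neq0 // expf_neq0 //; have := prodT _ T1.
  by rewrite -q0.
have nH : H != 0.
  apply: contra_neq (_ : H.[1] != 0) => [->|]; first by rewrite horner0.
  rewrite HH q1 // mulf_neq0 // expf_neq0 //; have := prodT _ T2.
  by rewrite -q1.
have nq : \prod_i q i != 0.
  apply: contra_neq (_ : (\prod_i q i).[0] != 0) => [->|]; first by rewrite horner0.
  by rewrite horner_prod; have := prodT _ T1; rewrite -q0.
have [s] := poly_nonroot (mulf_neq0 (mulf_neq0 nG nH) nq).
rewrite !hornerM horner_prod !mulf_eq0 !negb_or => /andP [/andP [Gs Hs] qs].
have Ts : in_torus (fun i => (q i).[s]) by move=> i; move/prodf_neq0: qs; apply.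
move: Gs Hs; rewrite HG // HH // !mulf_eq0 !negb_or => /andP [_ gs] /andP [_ hs].
by have /eqP := gh _ Ts; rewrite mulf_eq0 (negbTE gs) (negbTE hs).
Qed.

Definition tdense (r : nat) (D : point r -> Prop) := forall g, laurent g ->
  (forall t, D t -> g t = 0) -> forall t, in_torus t -> g t = 0.

Lemma tdense_sub r (D D' : point r -> Prop) : (forall t, D t -> D' t) -> tdense D -> tdense D'.
Proof. by move=> sub dD g Lg H; apply: dD => // t /sub; apply: H. Qed.

Lemma not_tdense r (D : point r -> Prop) : ~ tdense D -> exists g, [/\ laurent g,
  forall t, D t -> g t = 0 & exists2 t, in_torus t & g t != 0].
Proof.
move=> nD; apply: NNPP => H; apply: nD => g Lg gD t Ht; apply: NNPP => /eqP gt.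
by apply: H; exists g; split=> //; exists t.
Qed.

Lemma tdense_open r (D : point r -> Prop) g : tdense D -> laurent g ->
  (exists2 t, in_torus t & g t != 0) -> tdense (fun t => D t /\ g t != 0).
Proof.
move=> dD Lg [t0 T0 g0] h Lh H.
have [|H1|//] := laurent_mul_eq0 Lg Lh (dD _ (laurentM Lg Lh) _).
  move=> t Dt; have [->|gt] := eqVneq (g t) 0; first by rewrite mul0r.
  by rewrite H ?mulr0.
by rewrite H1 ?eqxx in g0.
Qed.

(** Irreducibility of the torus: otherwise the product of functions witnessing the non-density of
    the pieces would vanish on D, and one of them would be 0. *)
Lemma tdense_fin_cover r (D : point r -> Prop) (J : finType) (R : point r -> J -> Prop) :
  tdense D -> (forall t, D t -> exists j, R t j) ->
  exists j, tdense (fun t => D t /\ R t j).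
Proof.
move=> dD DR; apply: NNPP => nex.
have /fin_all_exists [g Hg] j := not_tdense (not_ex_all_not _ _ nex j).
have Lg j : laurent (g j) by case: (Hg j).
have P0 : forall t, in_torus t -> \prod_(j <- enum J) g j t = 0.
  apply: dD => [|t Dt]; first exact: laurent_prod.
  have [j Rj] := DR t Dt; rewrite (big_rem j) ?mem_enum //=.
  by have [_ -> //] := Hg j; rewrite mul0r.
elim: (enum J) P0 => [|j l IH] P0.
  by have /eqP := P0 (fun=> 1) (fun=> oner_neq0 _); rewrite big_nil oner_eq0.
have [|H|H] := laurent_mul_eq0 (Lg j) (laurent_prod l xpredT Lg).
- by move=> t /P0; rewrite big_cons.
- by have [_ _ [t Ht]] := Hg j; rewrite H // eqxx.
- exact: IH.
Qed.

(** * Closures of sets of torsion points *)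

(* The torsion coset c * T, with T the subtorus parametrized by xi |-> xi ^ u;
   w witnesses that the parametrization is an isomorphism onto T. *)
Record tcoset (n : nat) := TCoset {
  tc_dim : nat;
  tc_c : point n;
  tc_u : 'M[int]_(n, tc_dim);
  tc_w : 'M[int]_(tc_dim, n);
  tc_cP : torsion tc_c;
  tc_wu : tc_w *m tc_u = 1%:M }.

Definition tc_pt n (Z : tcoset n) (xi : point (tc_dim Z)) : point n :=
  pmul (tc_c Z) (mon (tc_u Z) xi).

Definition coset_covered n (T : point n -> Prop) := exists L : seq (tcoset n),
  (forall Z, List.In Z L -> tdense (fun xi => torsion xi /\ T (tc_pt (Z := Z) xi))) /\
  (forall t, T t -> exists Z xi, [/\ List.In Z L, torsion xi & t = tc_pt (Z := Z) xi]).

Lemma coset_covered_ext n (T T' : point n -> Prop) : (forall t, T t <-> T' t) ->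
  coset_covered T -> coset_covered T'.
Proof.
move=> TT [L [H1 H2]]; exists L; split=> [Z /H1|t /TT /H2 //].
by apply: tdense_sub => xi [? /TT].
Qed.

Lemma coset_covered_U n (T T' : point n -> Prop) : coset_covered T -> coset_covered T' ->
  coset_covered (fun t => T t \/ T' t).
Proof.
move=> [L [H1 H2]] [L' [H1' H2']]; exists (L ++ L'); split=> [Z ZL|t].
  have [/H1 dZ|/H1' dZ] := List.in_app_or _ _ _ ZL; apply: (tdense_sub _ dZ).
    by move=> xi [? ?]; split; [|left].
  by move=> xi [? ?]; split; [|right].
case=> [/H2|/H2'] [Z [xi [ZL ux Et]]]; exists Z, xi; split=> //; apply: List.in_or_app;
  by [left | right].
Qed.

Lemma coset_covered_bigU n (J : eqType) (l : seq J) (T : point n -> Prop) (R : J -> point n -> Prop) :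
  (forall j, j \in l -> coset_covered (fun t => T t /\ R j t)) ->
  (forall t, T t -> exists2 j, j \in l & R j t) -> coset_covered T.
Proof.
move=> H cov; apply: (@coset_covered_ext _ (fun t => T t /\ exists2 j, j \in l & R j t)).
  by move=> t; split=> [[]//|Tt]; split=> //; apply: cov.
elim: l {cov} H => [|j l IH] H.
  by exists [::]; split=> // t [_ []].
apply: coset_covered_ext (coset_covered_U (H j (mem_head _ _)) (IH _)) => [t|i il].
  split=> [[[Tt Rt]|[Tt [i il Ri]]]|[Tt [i]]].
  - by split=> //; exists j; rewrite ?mem_head.
  - by split=> //; exists i; rewrite // inE il orbT.
  - by rewrite inE => /orP [/eqP ->|il] Ri; [left | right; split=> //; exists i].
by apply: H; rewrite inE il orbT.
Qed.

(** Group a Laurent polynomial vanishing on T by distinct characters and fix one with nonzero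
    coefficient. At each t in T its class sums to 0 by [vanishing_sum_cosets], so it contains a
    second character, and their quotient at t is a W-th root of unity. *)
Lemma not_tdense_relations n (T : point n -> Prop) : (forall t, T t -> torsion t) ->
  ~ tdense T -> exists l : seq ('rV[int]_n * nat),
    (forall x, x \in l -> x.1 != 0 /\ (0 < x.2)%N) /\
    (forall t, T t -> exists2 x, x \in l & chr x.1 t ^+ x.2 = 1).
Proof.
move=> uT /not_tdense [g [[s Hs] gT [t0 T0 g0]]].
pose ex := undup [seq x.2 | x <- s]; pose k := size ex.
pose m (i : 'I_k) := nth 0 ex i.
have injm : injective m.
  by move=> i j /eqP; rewrite nth_uniq ?undup_uniq // => /eqP /val_inj.
pose a (i : 'I_k) := \sum_(x <- s | x.2 == m i) x.1.
have gE t : in_torus t -> g t = \sum_i a i * chr (m i) t.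
  move=> Ht; rewrite Hs // /laurent_val.
  have idx x : x \in s -> exists i, x.2 == m i.
    move=> xs; have xe : x.2 \in ex by rewrite mem_undup; apply: map_f.
    have ik : (index x.2 ex < k)%N by rewrite index_mem.
    by exists (Ordinal ik); rewrite /m /= nth_index.
  under [RHS]eq_bigr do rewrite mulr_suml big_mkcond /=.
  rewrite exchange_big /=; apply: eq_big_seq => x /idx [i xi].
  rewrite (bigD1 i) //= xi big1 ?addr0 ?(eqP xi) // => j ji.
  by rewrite (inj_eq injm) eq_sym (negbTE ji).
have [i0 a0] : exists i0, a i0 != 0.
  apply/existsP; rewrite -[X in is_true X]negbK negb_exists; apply/negP => /forallP H.
  by move: g0; rewrite gE // big1 ?eqxx // => i _; have /eqP -> := negPn (H i); rewrite mul0r.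
have [W W0 HW] := vanishing_sum_cosets a.
exists [seq (m i - m i0, W) | i <- enum 'I_k & i != i0]; split=> [x|t Tt].
  move=> /mapP [i]; rewrite mem_filter => /andP [ii0 _] -> /=; split=> //.
  by rewrite subr_eq0 (inj_eq injm).
have ut := uT _ Tt; have Ht := torsion_torus ut.
have E : \sum_i a i * chr (m i) t = 0 by rewrite -gE // gT.
have := HW (fun i => chr (m i) t) (fun i => mon_torsion (m i) ut 0) E _ (chr_neq0 (m i0) Ht).
rewrite (bigD1 i0) /=; last by rewrite divff ?expr1n // chr_neq0.
have [[i /andP [ii0 Hi]]|nex] := classic (exists i, (i != i0) && ((chr (m i) t / chr (m i0) t) ^+ W == 1)).
  move=> _; exists (m i - m i0, W); last by rewrite chrB //; apply/eqP.
  by apply: map_f; rewrite mem_filter ii0 mem_enum.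
rewrite big_pred0 ?addr0 => [/eqP|i]; last first.
  by apply/negbTE/negP => H; apply: nex; exists i; rewrite andbC.
by rewrite mulf_eq0 (negbTE a0) (negbTE (chr_neq0 _ Ht)).
Qed.

(** Smith normal form of a single row: m is a multiple of a primitive vector, which extends to a
    unimodular matrix. *)
Lemma unimodular_row n (m : 'rV[int]_n.+1) : m != 0 ->
  exists (R : 'M[int]_n.+1) (d : int), R \in unitmx /\ d != 0 /\ m = d *: row 0 R.
Proof.
move=> m0; have [L _ [R uR [d _ E]]] := int_Smith_normal_form m.
have Em : m = (L 0 0 * d`_0) *: row 0 R.
  rewrite {1}E; apply/rowP => j; rewrite mxE (bigD1 0) //= [X in _ + X]big1 ?addr0.
    by rewrite !mxE big_ord1 !mxE mulr1n.
  move=> i i0; rewrite mxE big_ord1 !mxE.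
  by rewrite eq_sym (_ : (i == 0%N :> nat) = false) ?mulr0n ?mulr0 ?mul0r //; apply: negbTE.
exists R, (L 0 0 * d`_0); split=> //; split=> //.
by apply: contra_neq m0 => Ed; rewrite Em Ed scale0r.
Qed.

Lemma roots_of_unity_seq W : (0 < W)%N -> exists l : seq algC,
  (forall z, (z \in l) = (z ^+ W == 1)).
Proof.
move=> W0; have [w pw] := C_prim_root_exists W0.
exists [seq w ^+ i | i <- iota 0 W] => z; apply/mapP/eqP => [[i _ ->]|].
  by rewrite exprAC (prim_expr_order pw) expr1n.
by move=> /(prim_rootP pw) [i ->]; exists (i : nat); rewrite // mem_iota add0n ltn_ord.
Qed.

Definition pcons n (a : algC) (t : point n) : point (1 + n) :=
  fun i => match split i with inl _ => a | inr j => t j end.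

Lemma pcons0 n a (t : point n) : pcons a t 0 = a.
Proof. by rewrite /pcons; case: splitP => // j /= /eqP; rewrite eqn_leq ltnn. Qed.

Lemma pconsE n (t : point (1 + n)) : t = pcons (t 0) (fun j => t (rshift 1 j)).
Proof.
apply: functional_extensionality => i; rewrite /pcons.
case: splitP => j E; congr (t _); apply: val_inj => //=.
by rewrite E ord1.
Qed.

Lemma pcons_torsion n a (t : point n) : runity a -> torsion t -> torsion (pcons a t).
Proof. by move=> ua ut i; rewrite /pcons; case: split. Qed.

Lemma pcons_tc n a (Z : tcoset n) xi : in_torus xi ->
  pcons a (tc_pt (Z := Z) xi) = pmul (pcons a (tc_c Z)) (mon (col_mx 0 (tc_u Z)) xi).
Proof.
move=> Hx; apply: functional_extensionality => i; rewrite /pmul /pcons /tc_pt.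
rewrite /mon; under [in RHS]eq_bigr do rewrite mxE; case: (split i) => j //.
rewrite -[LHS]mulr1; congr (_ * _).
by rewrite big1 // => l _; rewrite mxE expr0z.
Qed.

(** Induction on n. If T is not dense, each point satisfies one of finitely many relations chr m t ^
    W = 1. In coordinates where m is d times the first character, the first coordinate is one of
    finitely many roots of unity; with it fixed, the induction applies to the others. *)
Theorem torsion_coset_cover n (T : point n -> Prop) : (forall t, T t -> torsion t) ->
  coset_covered T.
Proof.
elim: n T => [|n IH] T uT; have [dT|nT] := classic (tdense T).
- have u1 : torsion (fun _ : 'I_0 => 1) by case.
  exists [:: TCoset u1 (mulmx1 1%:M)]; split=> [Z /= [<-|//]|t Tt].
    apply: tdense_sub dT => t Tt; split; first exact: uT.
    suff -> : tc_pt (Z := TCoset u1 (mulmx1 1%:M)) t = t by [].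
    by apply: functional_extensionality; case.
  exists (TCoset u1 (mulmx1 1%:M)), t; split; [by left|exact: uT|].
  by apply: functional_extensionality; case.
- have [l [Hl cov]] := not_tdense_relations uT nT.
  exists [::]; split=> // t /cov [x /Hl [x0 _] _].
  by case/eqP: x0; apply/rowP; case.
- have u1 : torsion (fun _ : 'I_n.+1 => 1) by move=> i; exact: runity1.
  pose Z1 := TCoset u1 (mulmx1 1%:M).
  have Z1E t : tc_pt (Z := Z1) t = t.
    by rewrite /tc_pt /= mon1; apply: functional_extensionality => i; rewrite /pmul mul1r.
  exists [:: Z1]; split=> [Z /= [<-|//]|t Tt].
    by apply: tdense_sub dT => t Tt; split; [exact: uT | rewrite Z1E].
  by exists Z1, t; split; [left|exact: uT|rewrite Z1E].
have [l [Hl cov]] := not_tdense_relations uT nT.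
apply: (coset_covered_bigU (l := l) (R := fun x t => chr x.1 t ^+ x.2 = 1)) => // [[m W]] xl.
have /= [m0 W0] := Hl _ xl.
have [R [d [uR [d0 Em]]]] := unimodular_row m0.
have dW0 : (0 < `|d| * W)%N by rewrite muln_gt0 absz_gt0 d0.
have Ed t : chr m t = mon R t 0 ^ d.
  rewrite /chr /mon Em.
  under eq_bigr do rewrite !mxE mulrC -exprz_exp.
  by symmetry; apply: (big_morph (fun x => x ^ d)) => [x y|]; rewrite ?expfzMl ?exp1rz.
have EdW t : (chr m t ^+ W == 1) = (mon R t 0 ^+ (`|d| * W) == 1).
  rewrite Ed exprM; case: (d) => b; rewrite ?NegzE /exprz //=.
  by rewrite exprVn invr_eq1.
have [om Hom] := roots_of_unity_seq dW0.
apply: (coset_covered_bigU (l := om) (R := fun w t => mon R t 0 = w)); last first.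
  move=> t [/uT /torsion_torus Ht /= E]; exists (mon R t 0) => //.
  by rewrite Hom -EdW E.
move=> w; rewrite Hom => /eqP wW.
have uw : runity w by exists (`|d| * W)%N.
pose Q := invmx R.
have RQ : R *m Q = 1%:M by apply: mulmxV.
have QR : Q *m R = 1%:M by apply: mulVmx.
have [|L [L1 L2]] := IH (fun eta => torsion eta /\ T (mon Q (pcons w eta))); first by move=> ? [].
have lift_c (Z : tcoset n) : torsion (mon Q (pcons w (tc_c Z))).
  by apply: mon_torsion; apply: pcons_torsion => //; apply: tc_cP.
have lift_wu (Z : tcoset n) :
    row_mx (0 : 'M_(_, 1)) (tc_w Z) *m (R : 'M_(1 + n)) *m
      ((Q : 'M_(1 + n)) *m col_mx (0 : 'M_(1, _)) (tc_u Z)) = 1%:M.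
  rewrite -mulmxA [X in _ *m X]mulmxA (RQ : (R : 'M_(1 + n)) *m (Q : 'M_(1 + n)) = 1%:M).
  by rewrite mul1mx mul_row_col mul0mx add0r tc_wu.
pose lift (Z : tcoset n) := TCoset (lift_c Z) (lift_wu Z).
have liftE Z xi : in_torus xi ->
    tc_pt (n := n.+1) (Z := lift Z) xi = mon Q (pcons w (tc_pt (Z := Z) xi)).
  by move=> Hx; rewrite pcons_tc // mon_pmul mon_comp.
have mQ eta : torsion eta -> mon R (mon Q (pcons w eta)) 0 = w.
  move=> ue; rewrite mon_comp; last by apply: torsion_torus; apply: pcons_torsion.
  by rewrite RQ mon1 pcons0.
exists (List.map lift L); split=> [Z' /List.in_map_iff [Z [<- /L1]] dZ|t [[Tt /= E] Rt]].
  apply: (tdense_sub _ dZ) => xi [ux [ue Te]]; split=> //.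
  rewrite (liftE _ _ (torsion_torus ux)); split; last exact: mQ.
  by split=> //=; apply/eqP; rewrite EdW mQ // wW.
have ut := uT _ Tt; have utt := torsion_torus ut.
pose eta : point n := fun j => mon R t (rshift 1 j).
have Et : t = mon Q (pcons w eta).
  by rewrite /eta -Rt -pconsE mon_comp // QR mon1.
have [|Z [xi [ZL ux Ee]]] := L2 eta.
  by split; [move=> j; apply: mon_torsion | rewrite -Et].
exists (lift Z), xi; split=> //; first by apply: List.in_map.
by rewrite (liftE _ _ (torsion_torus ux)) -Ee.
Qed.

(** * Reduced representations *)

Lemma vanishes_prod N (I : seq {mpoly algC[N]}) (J : eqType) (l : seq J) (q : J -> {mpoly algC[N]}) :
  geom_irred I -> vanishes_on_X I (\prod_(j <- l) q j) ->
  exists2 j, j \in l & vanishes_on_X I (q j).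
Proof.
move=> [[x0 X0] irr]; elim: l => [|j l IH].
  by rewrite big_nil => /(_ _ X0); rewrite meval1 => /eqP; rewrite oner_eq0.
rewrite big_cons => /irr [H|/IH [i il Hi]]; first by exists j; rewrite ?mem_head.
by exists i; rewrite // inE il orbT.
Qed.

Lemma not_zdense N (I : seq {mpoly algC[N]}) (S : point N -> Prop) : ~ zdense I S ->
  exists q : {mpoly algC[N]}, (forall x, S x -> q.@[x] = 0) /\ ~ vanishes_on_X I q.
Proof.
move=> nS; apply: NNPP => H; apply: nS => q qS; apply: NNPP => nq.
by apply: H; exists q.
Qed.

Lemma zdense_fin_cover N (I : seq {mpoly algC[N]}) (J : finType) (S : point N -> Prop)
    (R : J -> point N -> Prop) :
  geom_irred I -> zdense I S -> (forall x, S x -> exists j, R j x) ->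
  exists j, zdense I (R j).
Proof.
move=> irr dS SR; apply: NNPP => nex.
have /fin_all_exists [q Hq] j := not_zdense (not_ex_all_not _ _ nex j).
have [|j _ Hj] := @vanishes_prod _ I _ (enum J) q irr _; last by case: (Hq j).
apply: dS => x /SR [j Rj]; rewrite rmorph_prod /= (big_rem j) ?mem_enum //=.
by rewrite (Hq j).1 // mul0r.
Qed.

Section Representation.
Variables (N n : nat) (lab : 'I_n -> 'I_N).

Definition lcomb (e : 'I_n -> algC) (z : point n) : point N :=
  fun i => \sum_(k < n | lab k == i) e k * z k.

(** Setting z k = 1 where e k = 0 pins down the entries that [lcomb] does not see, so that every
    entry of z can later be compared with a monomial. *)
Definition reduced (e : 'I_n -> algC) (z : point n) :=
  (forall k, e k = 0 -> z k = 1) /\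
  forall (i : 'I_N) (J : {set 'I_n}), (forall k, k \in J -> lab k = i /\ e k != 0) ->
    \sum_(k in J) e k * z k = 0 -> J = set0.

(** Setting the coefficients of a vanishing subsum to 0 does not change the point and lowers the
    number of nonzero coefficients. *)
Lemma reduced_representation (E : seq algC) (e : 'I_n -> algC) (z : point n) : 0 \in E ->
  (forall k, e k \in E) -> torsion z -> exists (e' : 'I_n -> algC) (z' : point n),
    [/\ forall k, e' k \in E, torsion z', lcomb e' z' = lcomb e z & reduced e' z'].
Proof.
move=> E0; have [m lm] := ubnP #|[set k | e k != 0]|.
elim: m e lm => // m IH e; rewrite ltnS => lm Ee uz.
have [[i [J [HJ [SJ nJ]]]]|nex] := classic (exists (i : 'I_N) (J : {set 'I_n}),
    (forall k, k \in J -> lab k = i /\ e k != 0) /\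
    \sum_(k in J) e k * z k = 0 /\ J <> set0).
  pose e1 k := if k \in J then 0 else e k.
  have [k kJ] : exists k, k \in J by apply/set0Pn/eqP.
  have [||//|e' [z' [Ee' uz' El re']]] := IH e1.
  - apply: leq_trans lm; apply: proper_card; apply/properP; split.
      apply/subsetP => l; rewrite !inE /e1; case: ifP => // _; by rewrite eqxx.
    by exists k; rewrite !inE ?(HJ k kJ).2 // /e1 kJ eqxx.
  - by move=> l; rewrite /e1; case: ifP.
  exists e', z'; split=> //; rewrite El.
  apply: functional_extensionality => l; rewrite /lcomb.
  have [->|li] := eqVneq l i; last first.
    apply: eq_bigr => k' /eqP Hk; rewrite /e1; case: ifP => // /HJ [Hl _].
    by move: li; rewrite -Hk Hl eqxx.
  have EJ : \sum_(k' < n | (lab k' == i) && (k' \in J)) e k' * z k' = 0.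
    rewrite -[RHS]SJ; apply: eq_bigl => k'; apply/andP/idP => [[]//|k'J].
    by split=> //; apply/eqP; apply: (HJ _ k'J).1.
  rewrite [RHS](bigID (mem J)) /= EJ add0r (bigID (mem J)) /= [X in X + _]big1 ?add0r.
    by apply: eq_bigr => k' /andP [_ /negbTE k'J]; rewrite /e1 k'J.
  by move=> k' /andP [_ k'J]; rewrite /e1 k'J mul0r.
pose z' k := if e k == 0 then 1 else z k.
have ez k : e k * z' k = e k * z k by rewrite /z'; case: eqP => [->|//]; rewrite !mul0r.
exists e, z'; split=> //.
- by move=> k; rewrite /z'; case: ifP => _ //; apply: runity1.
- by apply: functional_extensionality => i; apply: eq_bigr => k _; apply: ez.
split=> [k ek|i J HJ SJ]; first by rewrite /z' ek eqxx.
apply: NNPP => nJ; apply: nex; exists i, J; split=> //; split=> //.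
by rewrite -[RHS]SJ; apply: eq_bigr => k _; rewrite ez.
Qed.

End Representation.

(** Every coordinate gets B slots, padded with terms 0 * 1, so that all points share one shape. *)
Lemma unity_comb_representation (N B : nat) (E : seq algC) : exists (n : nat) (lab : 'I_n -> 'I_N),
  forall y : point N, (forall i, unity_comb B E (y i)) ->
  exists (e : 'I_n -> algC) (z : point n),
    [/\ forall k, e k \in 0 :: E, torsion z & y = lcomb lab e z].
Proof.
exists #|{: 'I_N * 'I_B}|, (fun k => (enum_val k).1) => y Hy.
have /fin_all_exists [s Hs] i := Hy i.
pose f (p : 'I_N * 'I_B) := nth (0, 1) (s p.1) p.2.
exists (fun k => (f (enum_val k)).1), (fun k => (f (enum_val k)).2).
have fP p : (f p).1 \in 0 :: E /\ runity (f p).2.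
  rewrite /f; have [_ Hu _] := Hs p.1.
  have [lt|ge] := ltnP p.2 (size (s p.1)).
    by have [uE ur] := Hu _ (mem_nth (0, 1) lt); rewrite inE uE orbT.
  by rewrite nth_default //= mem_head; split=> //; apply: runity1.
split=> [k|k|]; [by case: (fP (enum_val k)) | by case: (fP (enum_val k)) |].
apply: functional_extensionality => i; have [szs _ ->] := Hs i; rewrite /lcomb.
rewrite (reindex (@enum_rank _)) /=; last by apply: onW_bij; apply: enum_rank_bij.
under [RHS]eq_bigl do rewrite enum_rankK.
under [RHS]eq_bigr do rewrite enum_rankK.
transitivity (\sum_(j < B) (nth (0, 1) (s i) j).1 * (nth (0, 1) (s i) j).2).
  rewrite (big_nth (0, 1)) big_mkord.
  rewrite (big_ord_widen B (fun j => (nth (0, 1) (s i) j).1 * (nth (0, 1) (s i) j).2)) //.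
  rewrite [LHS]big_mkcond; apply: eq_bigr => j _; case: ltnP => // ge.
  by rewrite nth_default //= mul0r.
transitivity (\sum_(l | l == i) \sum_(j < B) (f (l, j)).1 * (f (l, j)).2).
  by rewrite big_pred1_eq.
by rewrite pair_big_dep /=; apply: eq_big => [[l j]|[l j] _] //=; rewrite andbT.
Qed.

Lemma In_tnth (T : Type) (s : seq T) x : List.In x s -> exists j : 'I_(size s), x = tnth (in_tuple s) j.
Proof.
elim: s => //= a s IH [->|/IH [j ->]]; first by exists ord0; rewrite (tnth_nth x).
by exists (lift ord0 j); rewrite !(tnth_nth x).
Qed.

Lemma tnth_In (T : Type) (s : seq T) (j : 'I_(size s)) : List.In (tnth (in_tuple s) j) s.
Proof.
rewrite (tnth_nth (tnth (in_tuple s) j)) /=; move: (tnth _ _) => x0.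
elim: s j => [[]|a s IH] //= [[|j] Hj] /=; [by left | right].
exact: (IH (Ordinal (Hj : (j < size s)%N))).
Qed.

Lemma pigeonhole (J : finType) (f : nat -> J) : exists a b, (a < b)%N /\ f a = f b.
Proof.
have : ~ injective (fun i : 'I_#|J|.+1 => f i).
  by move=> /leq_card; rewrite card_ord ltnn.
move=> ninj; apply: NNPP => H; apply: ninj => i j Eij; apply: val_inj => /=.
apply/eqP; case: ltngtP => // lt; case: H; [by exists i, j | by exists j, i].
Qed.

(** * The dynamics on torsion cosets *)

(* A vanishing sum of Laurent monomials in xi and of the terms of a reduced
   representation z forces every z k to be a bounded root of unity times one of
   the monomials: otherwise the coset class of z k would be a vanishing subsum. *)
Lemma reduced_monomial (N n r : nat) (lab : 'I_n -> 'I_N) (e : 'I_n -> algC) (i : 'I_N)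
    (s : seq (algC * 'rV[int]_r)) : exists2 W, (0 < W)%N &
  forall (xi : point r) (z : point n), torsion xi -> torsion z -> reduced lab e z ->
    laurent_val s xi = lcomb lab e z i ->
  forall k, lab k = i -> e k != 0 ->
    exists2 m, m \in [seq x.2 | x <- s] & (z k / chr m xi) ^+ W = 1.
Proof.
pose x0 : algC * 'rV[int]_r := (0, 0).
(* One vanishing sum: the monomials of s in the first block, the terms of coordinate i with opposite
   sign in the second. *)
pose a (j : 'I_(size s + n)) := match split j with
  | inl x => (nth x0 s x).1 | inr k => if (lab k == i) && (e k != 0) then - e k else 0 end.
have [W W0 HW] := vanishing_sum_cosets a; exists W => // xi z uxi uz [_ red] Es k lk ek.
have Txi := torsion_torus uxi.
pose rho (j : 'I_(size s + n)) := match split j with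
  | inl x => chr (nth x0 s x).2 xi | inr k => z k end.
have urho j : runity (rho j).
  by rewrite /rho; case: split => l //; apply: mon_torsion.
have Efilter (Q : pred 'I_n) :
    \sum_(l | Q l) (if (lab l == i) && (e l != 0) then - e l else 0) * z l =
    - \sum_(l | Q l && ((lab l == i) && (e l != 0))) e l * z l.
  rewrite -sumrN [RHS]big_mkcondr; apply: eq_bigr => l _ /=.
  by case: ifP => _; rewrite ?mulNr ?mul0r.
have E0 : \sum_j a j * rho j = 0.
  rewrite big_split_ord /=.
  under eq_bigr do rewrite /a /rho (unsplitK (inl _)).
  under [X in _ + X]eq_bigr do rewrite /a /rho (unsplitK (inr _)).
  rewrite (Efilter xpredT) /=.
  have -> : \sum_(x < size s) (nth x0 s x).1 * chr (nth x0 s x).2 xi = laurent_val s xi.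
    by rewrite /laurent_val (big_nth x0) big_mkord.
  rewrite Es /lcomb (bigID (fun l => e l != 0)) /= [X in _ + X - _]big1 ?addr0 ?subrr //.
  by move=> l /andP [_ /negPn /eqP ->]; rewrite mul0r.
have := HW rho urho E0 (z k) (runity_neq0 (uz k)).
rewrite big_split_ord /=.
under eq_bigl do rewrite /rho (unsplitK (inl _)).
under eq_bigr do rewrite /a /rho (unsplitK (inl _)).
under [X in _ + X]eq_bigl do rewrite /rho (unsplitK (inr _)).
under [X in _ + X]eq_bigr do rewrite /a /rho (unsplitK (inr _)).
have [[x Hx] _|nex] := classic (exists x : 'I_(size s), (chr (nth x0 s x).2 xi / z k) ^+ W == 1).
  exists (nth x0 s x).2; first by apply: map_f; apply: mem_nth.
  by rewrite -[_ / _]invrK invfM invrK mulrC exprVn (eqP Hx) invr1.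
rewrite big_pred0 ?add0r; last by move=> x; apply/negbTE/negP => Hx; apply: nex; exists x.
rewrite Efilter => /eqP; rewrite oppr_eq0 => /eqP SJ.
pose J := [set l | ((z l / z k) ^+ W == 1) && ((lab l == i) && (e l != 0))].
have : J = set0.
  apply: (red i) => [l|]; first by rewrite inE => /and3P [_ /eqP -> ->].
  by rewrite -[RHS]SJ; apply: eq_bigl => l; rewrite inE.
move/setP/(_ k); rewrite !inE lk eqxx ek divff ?expr1n ?eqxx //.
exact: runity_neq0.
Qed.

Section Dynamics.
Variables (N : nat) (I : seq {mpoly algC[N]}) (F : 'I_N -> {mpoly algC[N]}) (P : point N -> Prop).
Hypotheses (irr : geom_irred I) (dom : dominant_endo I F).
Hypothesis (AI : ~ zdense I (fun y => P y /\ ~ P (poly_map F y))).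
Variables (n : nat) (lab : 'I_n -> 'I_N) (K : finType).
Variables (e : K -> 'I_n -> algC) (Z : K -> tcoset n).

Local Notation dim j := (tc_dim (Z j)).
Definition psi (j : K) (xi : point (dim j)) : point N := lcomb lab (e j) (tc_pt xi).
Definition dom_pt (j : K) (xi : point (dim j)) :=
  [/\ torsion xi, P (psi xi) & reduced lab (e j) (tc_pt xi)].

Hypothesis dD : forall j, tdense (@dom_pt j).
Hypothesis cover : forall y, P y -> exists j xi, @dom_pt j xi /\ y = psi xi.

Lemma tc_pt_laurent m (Z' : tcoset m) k : laurent (fun xi => tc_pt (Z := Z') xi k).
Proof.
apply: laurent_ext (laurent_monom (tc_c Z' k) (row k (tc_u Z'))) => t _.
by rewrite /tc_pt /pmul mon_row.
Qed.

Lemma psi_laurent j i : laurent (fun xi => @psi j xi i).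
Proof.
apply: laurent_sum => k; apply: laurentM; first exact: laurent_const.
exact: tc_pt_laurent.
Qed.

Definition good j := zdense I (fun y => exists xi, @dom_pt j xi /\ y = psi xi).

Lemma good_exists : zdense I P -> exists j, good j.
Proof. by move=> dP; apply: zdense_fin_cover irr dP cover. Qed.

Definition step (j j' : K) (l : nat) := exists (g : point (dim j')) (A : 'M[int]_(dim j', dim j)),
  torsion g /\ forall xi : point (dim j), in_torus xi ->
    iter l (poly_map F) (psi xi) = psi (pmul g (mon A xi)).

Lemma step_trans j j' j'' l l' : step j j' l -> step j' j'' l' -> step j j'' (l' + l).
Proof.
move=> [g [A [ug H]]] [g' [A' [ug' H']]].
exists (pmul g' (mon A' g)), (A' *m A); split.
  by apply: pmul_torsion => //; apply: mon_torsion.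
move=> xi Txi; have Tg := torsion_torus ug.
rewrite iterD H // H'; last by apply: pmul_torus => //; apply: mon_torus.
congr psi; rewrite mon_pmul mon_comp //.
by apply: functional_extensionality => i; rewrite /pmul mulrA.
Qed.

Lemma tc_pt_inv m (Z' : tcoset m) xi : in_torus xi ->
  mon (tc_w Z') (tc_pt (Z := Z') xi) = pmul (mon (tc_w Z') (tc_c Z')) xi.
Proof. by move=> Txi; rewrite /tc_pt mon_pmul mon_comp // tc_wu mon1. Qed.

(** As w is a left inverse of u, the parameter is recovered from its point up to a fixed torsion
    factor; monomial coordinates thus give a monomial map of parameters. *)
Lemma tc_pt_monomial m (Z' : tcoset m) r (om : point m) (M : 'M[int]_(m, r)) (xi' : point (tc_dim Z')) xi :
  in_torus xi -> in_torus xi' -> tc_pt xi' = pmul om (mon M xi) ->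
  xi' = pmul (pmul (fun i => (mon (tc_w Z') (tc_c Z') i)^-1) (mon (tc_w Z') om)) (mon (tc_w Z' *m M) xi).
Proof.
move=> Txi Txi' E; have := tc_pt_inv Txi'; rewrite E mon_pmul mon_comp // => E'.
apply: functional_extensionality => i; move: (congr1 (fun f => f i) E'); rewrite /pmul => Ei.
rewrite -mulrA Ei mulrA mulVf ?mul1r //.
exact: (mon_torus _ (torsion_torus (@tc_cP _ Z'))).
Qed.

(** q0 comes from (AI): where it is nonzero, f keeps points of P in P. The q j detect the images of
    cosets that are not good. Not all selected points of a good coset can be zeros of the product: X
    is irreducible, and if q j after f vanished on X, then q j would vanish on the dense set
    f(X). *)
Lemma generic_test_polynomials : exists (q0 : {mpoly algC[N]}) (q : K -> {mpoly algC[N]}),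
  [/\ forall x, P x -> q0.@[x] != 0 -> P (poly_map F x),
      forall j x, ~ good j -> (exists xi, @dom_pt j xi /\ x = psi xi) -> (q j).@[x] = 0 &
      forall j, good j -> exists2 xi, @dom_pt j xi &
        (q0.@[psi xi] * \prod_j' (q j').@[poly_map F (psi xi)] != 0)].
Proof.
have [q0 [H0 nv0]] := not_zdense AI.
have /fin_all_exists [q Hq] (j : K) : exists q : {mpoly algC[N]}, ~ vanishes_on_X I q /\
    (~ good j -> forall x, (exists xi, @dom_pt j xi /\ x = psi xi) -> q.@[x] = 0).
  have [gj|/not_zdense [q [Hq nq]]] := classic (good j); last by exists q.
  exists 1; split=> // H; have [[x X] _] := irr.
  by have /eqP := H x X; rewrite meval1 oner_eq0.
exists q0, q; split=> [x Px q0x|j x ng Hx|j gj]; last 1 first.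
- apply: NNPP => nex.
  pose qF j' := q j' \mPo [tuple F i | i < N].
  have qFE j' x : (qF j').@[x] = (q j').@[poly_map F x].
    by rewrite comp_mpoly_meval; apply: meval_eq => i; rewrite tnth_mktuple.
  have V : vanishes_on_X I (q0 * \prod_(j' <- enum K) qF j').
    apply: gj => _ [xi [Dxi ->]]; apply/eqP/negPn/negP => H; apply: nex.
    exists xi => //; move: H; rewrite mevalM rmorph_prod /= big_enum /=.
    by under eq_bigr do rewrite qFE.
  have [//|V'] := irr.2 _ _ V.
  have [j' _ Vj'] := vanishes_prod irr V'.
  apply: (Hq j').1; apply: dom => _ [x [X ->]].
  by rewrite -qFE; apply: Vj'.
- apply: NNPP => nPF; case/eqP: q0x; apply: H0; by split.
- exact: (Hq j).2 ng x Hx.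
Qed.

Lemma tdense_inhabited r (D : point r -> Prop) : tdense D -> exists t, D t.
Proof.
move=> dense; apply: NNPP => nex.
have /eqP := dense (fun=> 1) (@laurent_const r 1) (fun t Dt => False_ind _ (nex (ex_intro _ t Dt)))
  (fun=> 1) (fun=> oner_neq0 _).
by rewrite oner_eq0.
Qed.

(** On a dense set f lands in P, on a good coset, with each entry one of finitely many roots of
    unity times one of finitely many monomials. One such choice holds on a dense set, and the
    resulting identity of Laurent polynomials extends to the torus. *)
Lemma step_exists j : good j -> exists2 j', good j' & step j j' 1.
Proof.
move=> gj; have [q0 [q [Hq0 Hq Hgood]]] := generic_test_polynomials.
pose g xi := q0.@[@psi j xi] * \prod_j' (q j').@[poly_map F (psi xi)].
have LF i : laurent (fun xi => (F i).@[@psi j xi]).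
  by apply: laurent_meval => k; apply: psi_laurent.
have Lg : laurent g.
  apply: laurentM; first by apply: laurent_meval => k; apply: psi_laurent.
  by apply: laurent_prod => j'; apply: laurent_meval => k; apply: LF.
have D1 : tdense (fun xi => @dom_pt j xi /\ g xi != 0).
  apply: tdense_open => //; have [xi [uxi _ _] gxi] := Hgood j gj.
  by exists xi => //; apply: torsion_torus.
have /fin_all_exists [ls Hls] i := LF i.
have /fin_all_exists [W HW] (x : K * 'I_N) : exists W, (0 < W)%N /\
  forall (xi : point (dim j)) (z : point n), torsion xi -> torsion z -> reduced lab (e x.1) z ->
    laurent_val (ls x.2) xi = lcomb lab (e x.1) z x.2 ->
  forall k, lab k = x.2 -> e x.1 k != 0 ->
    exists2 m, m \in [seq x.2 | x <- ls x.2] & (z k / chr m xi) ^+ W = 1.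
  by have [W W0 HW] := reduced_monomial lab (e x.1) x.2 (ls x.2); exists W.
have /fin_all_exists [om Hom] (x : K * 'I_N) := roots_of_unity_seq (HW x).1.
(* The leading 0 here and 1 in [Os] serve the entries with zero coefficient, equal to 1 by
   reducedness. *)
pose Ms := 0 :: flatten [seq [seq x.2 | x <- ls i] | i <- enum 'I_N].
pose Os := 1 :: flatten [seq om x | x <- enum {: K * 'I_N}].
pose J := (K * {ffun 'I_n -> 'I_(size Ms) * 'I_(size Os)})%type.
pose mm (t : {ffun 'I_n -> 'I_(size Ms) * 'I_(size Os)}) : 'M[int]_(n, dim j) :=
  \matrix_(k, l) (Ms`_(t k).1) 0 l.
pose oo (t : {ffun 'I_n -> 'I_(size Ms) * 'I_(size Os)}) : point n := fun k => Os`_(t k).2.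
pose R xi (x : J) := good x.1 /\ exists xi', [/\ @dom_pt x.1 xi',
   poly_map F (@psi j xi) = psi xi' & tc_pt xi' = pmul (oo x.2) (mon (mm x.2) xi)].
have [xi [[uxi Pxi redxi] gxi]|[j' t] D2] := tdense_fin_cover (R := R) D1.
  have PF : P (poly_map F (psi xi)).
    by apply: Hq0 => //; apply: contra_neq gxi; rewrite /g => ->; rewrite mul0r.
  have [j' [xi' [Dxi' Exi']]] := cover PF; have [uxi' Pxi' redxi'] := Dxi'.
  have gj' : good j'.
    apply: NNPP => nj'; case/eqP: gxi; rewrite /g (bigD1 j') //= Hq ?mul0r ?mulr0 //.
    by exists xi'.
  have utc : torsion (tc_pt xi') by apply: pmul_torsion; [apply: tc_cP | apply: mon_torsion].
  have Hk k : exists x : 'I_(size Ms) * 'I_(size Os), tc_pt xi' k = Os`_x.2 * chr Ms`_x.1 xi.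
    have [ek|ek] := eqVneq (e j' k) 0.
      exists (ord0, ord0) => /=; rewrite chr0 mulr1; exact: redxi'.1.
    have [m mls Em] : exists2 m, m \in [seq x.2 | x <- ls (lab k)] &
        (tc_pt xi' k / chr m xi) ^+ W (j', lab k) = 1.
      apply: (HW (j', lab k)).2 => //=.
      rewrite -Hls; last exact: torsion_torus.
      by rewrite -[LHS]/(poly_map F (psi xi) (lab k)) Exi'.
    have mMs : m \in Ms.
      by rewrite inE; apply/orP; right; apply/flatten_mapP; exists (lab k); rewrite ?mem_enum.
    have oOs : tc_pt xi' k / chr m xi \in Os.
      rewrite inE; apply/orP; right; apply/flatten_mapP; exists (j', lab k); rewrite ?mem_enum //.
      by rewrite Hom; apply/eqP.
    have iM : (index m Ms < size Ms)%N by rewrite index_mem.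
    have iO : (index (tc_pt xi' k / chr m xi) Os < size Os)%N by rewrite index_mem.
    exists (Ordinal iM, Ordinal iO); rewrite !nth_index //= divfK //.
    by apply: chr_neq0; apply: torsion_torus.
  have /fin_all_exists [t Ht] := Hk.
  exists (j', [ffun k => t k]); split=> //; exists xi'; split=> //.
  apply: functional_extensionality => k; rewrite Ht /pmul /oo ffunE mon_row; congr (_ * chr _ _).
  by apply/rowP => l; rewrite !mxE ffunE.
exists j'.
  by have [xi [_ [gj' _]]] := tdense_inhabited D2.
pose gam := pmul (fun i => (mon (tc_w (Z j')) (tc_c (Z j')) i)^-1) (mon (tc_w (Z j')) (oo t)).
have uoo : torsion (oo t).
  move=> k; rewrite /oo; have := mem_nth 0 (ltn_ord (t k).2); rewrite inE => /orP [/eqP ->|].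
    exact: runity1.
  move=> /flatten_mapP [x _]; rewrite Hom => /eqP E; exists (W x) => //; exact: (HW x).1.
have ugam : torsion gam.
  apply: pmul_torsion; last exact: mon_torsion.
  by move=> i; apply: runityV; apply: mon_torsion; apply: tc_cP.
exists gam, (tc_w (Z j') *m mm t); split=> // xi Txi /=.
apply: functional_extensionality => i; apply/eqP; rewrite -subr_eq0; apply/eqP.
move: xi Txi; apply: D2.
  apply: laurentD; first exact: LF.
  apply: laurent_ext (laurentM (@laurent_const _ (-1))
    (laurent_subst (tc_w (Z j') *m mm t) (torsion_torus ugam) (psi_laurent j' i))) => xi _.
  by rewrite mulN1r.
move=> xi [[[uxi _ _] _] [_ [xi' [[uxi' _ _] Exi' Etc]]]].
have := tc_pt_monomial (torsion_torus uxi) (torsion_torus uxi') Etc.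
rewrite -/gam => Exi2; rewrite -Exi2.
by rewrite -[X in X - _]/(poly_map F (psi xi) i) Exi' subrr.
Qed.

(** Choosing a successor for each good coset gives a self-map of a finite set, whose orbits
    repeat. *)
Lemma cycle_exists j0 : good j0 -> exists j l, [/\ good j, (0 < l)%N & step j j l].
Proof.
move=> g0.
have /fin_all_exists [s Hs] j : exists j', good j -> good j' /\ step j j' 1.
  by have [/step_exists [j' gj' sj']|ng] := classic (good j); [exists j' | exists j].
pose x k := iter k s j0.
have gx k : good (x k) by elim: k => [|k IH] //=; apply: (Hs _ IH).1.
have sx a k : step (x a) (x (a + k.+1)%N) k.+1.
  elim: k => [|k IH]; first by rewrite addn1; apply: (Hs _ (gx a)).2.
  by rewrite addnS -[k.+2]add1n; apply: step_trans IH _; apply: (Hs _ (gx _)).2.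
have [a [b [ab Eab]]] := pigeonhole x.
exists (x a), (b - a)%N; split=> //; first by rewrite subn_gt0.
have [k Dk] : exists k, b = (a + k.+1)%N by exists (b - a.+1)%N; rewrite addnS -addSn subnKC.
have := sx a k; rewrite -Dk -Eab.
by have -> : k.+1 = (b - a)%N by rewrite Dk addKn.
Qed.

(* The translation part of the cycle is torsion, so it has an eventually
   periodic orbit on a finite group; a point of the periodic part absorbs it. *)
Lemma cycle_group_endo j l : (0 < l)%N -> step j j l ->
  exists (l' : nat) (del : point (dim j)) (A : 'M[int]_(dim j)),
  [/\ (0 < l')%N, torsion del & forall xi, in_torus xi ->
    iter l' (poly_map F) (psi (pmul del xi)) = psi (pmul del (mon A xi))].
Proof.
move=> l0 [g [A [ug H]]].
(* The orbit of 1 under xi -> g xi^A, contained in the W-torsion when g is. *)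
pose del k := iter k (fun d => pmul g (mon A d)) (fun=> 1 : algC).
have udel k : torsion (del k).
  by elim: k => [|k IH] i /=; [apply: runity1 | apply: pmul_torsion => //; apply: mon_torsion].
have [|W W0 HW] := @runity_common [seq g i | i <- enum 'I_(dim j)].
  by move=> _ /mapP [i _ ->].
have {}HW i : g i ^+ W = 1 by apply: HW; apply: map_f; rewrite mem_enum.
have delW k i : del k i ^+ W = 1.
  elim: k i => [|k IH] i /=; first by rewrite expr1n.
  rewrite /pmul exprMn HW mul1r /mon -prodrXl big1 // => q _.
  by rewrite -[_ ^+ W]/(_ ^ W%:Z) exprz_exp mulrC -exprz_exp -[_ ^ W%:Z]/(_ ^+ W) IH exp1rz.
have [om Hom] := roots_of_unity_seq W0.
pose code k : {ffun 'I_(dim j) -> 'I_(size om).+1} := [ffun i => inord (index (del k i) om)].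
have codeK a b : code a = code b -> del a = del b.
  move=> E; apply: functional_extensionality => i.
  have om_i k : del k i \in om by rewrite Hom delW.
  have := congr1 (fun f : {ffun 'I_(dim j) -> 'I_(size om).+1} => nth 0 om (f i)) E.
  by rewrite !ffunE !inordK ?ltnS ?index_size // !nth_index.
have [a [b [ab /codeK Eab]]] := pigeonhole code.
(* The translation moves along the orbit while B collects the monomial part; between two equal orbit
   points the translation is unchanged. *)
have iterH k m : exists B : 'M[int]_(dim j), forall xi, in_torus xi ->
    iter (m * l) (poly_map F) (psi (pmul (del k) xi)) = psi (pmul (del (k + m)%N) (mon B xi)).
  elim: m => [|m [B HB]]; first by exists 1%:M => xi _; rewrite addn0 mon1.
  exists (A *m B) => xi Txi; rewrite mulSn iterD HB // H; last first.
    by apply: pmul_torus; [apply: torsion_torus | apply: mon_torus].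
  congr psi; rewrite addnS /= mon_pmul mon_comp //.
  by apply: functional_extensionality => i; rewrite /pmul mulrA.
have [B HB] := iterH a (b - a)%N; rewrite subnKC ?(ltnW ab) // -Eab in HB.
exists ((b - a) * l)%N, (del a), B; split=> //.
by rewrite muln_gt0 subn_gt0 ab.
Qed.

End Dynamics.

(** * Assembly of the cosets and of the monomial semiconjugacy *)

Lemma chr_mpoly n (m : 'rV[int]_n) : exists p : {mpoly algC[n + n]},
  forall t, in_torus t -> p.@[tt_inv t] = chr m t.
Proof.
exists (\prod_j (if m 0 j is Posz a then 'X_(lshift n j) ^+ a else 'X_(rshift n j) ^+ `|m 0 j|)).
move=> t Tt; rewrite rmorph_prod /=; apply: eq_bigr => j _.
case: (m 0 j) => a; rewrite rmorphXn /= mevalXU /tt_inv.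
  by rewrite (unsplitK (inl j)).
by rewrite (unsplitK (inr j)) NegzE /= exprVn.
Qed.

Lemma loxton_bounded_height (theta : algC) (N M : nat) (P : point N -> Prop) (c : algC) :
  (0 < M)%N -> 0 <= c -> (forall y, P y -> forall i, inOKc theta (M%:R * y i)) ->
  (forall y, P y -> forall (i : 'I_N) (sigma : {rmorphism algC -> algC}), `|sigma (y i)| <= c) ->
  exists B E, forall y, P y -> forall i, unity_comb B E (y i).
Proof.
move=> M0 c0 dci bh; have Mn0 : M%:R != 0 :> algC by rewrite pnatr_eq0 -lt0n.
have [B [E HE]] := loxton_Kc theta (M * Num.bound c).
exists B, [seq M%:R^-1 * e | e <- E] => y Py i.
rewrite -[y i](mulKf Mn0).
apply: (unity_comb_scale _ (HE _ (dci y Py i) _)) => [x xE|nu]; first exact: map_f.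
rewrite rmorphM rmorph_nat normrM normr_nat natrM ler_wpM2l ?ler0n //.
by apply: le_trans (bh y Py i nu) (ltW (archi_boundP c0)).
Qed.

Theorem theorem1p2 (theta : algC) (N d : nat) (I : seq {mpoly algC[N]})
    (F : 'I_N -> {mpoly algC[N]}) (P : point N -> Prop) :
  (forall p, p \in I -> coef_in_K theta p) ->
  geom_irred I -> vdim I d -> (1 <= d)%N ->
  (forall k, coef_in_K theta (F k)) -> maps_into I F -> dominant_endo I F ->
  (forall y, P y -> onX I y) ->
  (* (DCI) *)
  zdense I P ->
  (exists M : nat, (1 <= M)%N /\
     forall y, P y -> forall i, inOKc theta (M%:R * y i)) ->
  (* (BH) *)
  (exists c : algC, 0 < c /\
     forall y, P y -> forall (i : 'I_N) (sigma : {rmorphism algC -> algC}),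
       `|sigma (y i)| <= c) ->
  (* (AI) *)
  ~ zdense I (fun y => P y /\ ~ P (poly_map F y)) ->
  monomial_type I d F.
Proof.
move=> _ irr _ _ _ _ dom PX dP [M [M0 dci]] [c [c0 bh]] AI.
have [B [E HE]] := loxton_bounded_height M0 (ltW c0) dci bh.
have [n [lab rep]] := unity_comb_representation N B E.
pose E0 := 0 :: E; pose ec := {ffun 'I_n -> 'I_(size E0)}.
pose e (f : ec) (k : 'I_n) := E0`_(f k).
(* Membership in P and reducedness belong to the set being covered, so they hold on a dense set of
   parameters of each coset. *)
have uT f t : [/\ torsion t, P (lcomb lab (e f) t) & reduced lab (e f) t] -> torsion t by case.
have /fin_all_exists [L HL] f := torsion_coset_cover (uT f).
pose J : finType := {f : ec & 'I_(size (L f))}.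
pose eJ (x : J) := e (tag x).
pose ZJ (x : J) : tcoset n := tnth (in_tuple (L (tag x))) (tagged x).
have dD x : tdense (@dom_pt N P n lab J eJ ZJ x).
  have [HL1 _] := HL (tag x).
  by apply: tdense_sub (HL1 _ (tnth_In (tagged x))) => xi [uxi [_ Pxi rxi]].
have cover y : P y -> exists j xi, @dom_pt N P n lab J eJ ZJ j xi /\ y = psi (Z := ZJ) lab eJ xi.
  move=> Py; have [e1 [z1 [Ee1 uz1 Ey1]]] := rep y (HE y Py).
  have [e2 [z2 [Ee2 uz2 Ey2 red]]] := reduced_representation lab (mem_head 0 E) Ee1 uz1.
  have ik k : (index (e2 k) E0 < size E0)%N by rewrite index_mem.
  pose f : ec := [ffun k => Ordinal (ik k)].
  have ef : e f = e2 by apply: functional_extensionality => k; rewrite /e ffunE nth_index.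
  have [_ HL2] := HL f; have [|Z [xi [ZL uxi Ez]]] := HL2 z2.
    by rewrite ef Ey2 -Ey1.
  have [l El] := In_tnth ZL.
  subst Z; exists (existT _ f l), xi; rewrite /dom_pt /psi /eJ /ZJ /= -Ez ef Ey2 -Ey1.
  by split.
have [j0 g0] := good_exists irr cover dP.
have [j [l [gj l0 sj]]] := cycle_exists irr dom AI dD cover g0.
have [l' [del [A [l'0 udel H]]]] := cycle_group_endo l0 sj.
have Tdel := torsion_torus udel.
set r := tc_dim (ZJ j) in del A udel H Tdel.
(* The torus is enlarged by d coordinates with exponent 0, so that its dimension r + d is at least
   d. *)
have /fin_all_exists [p Hp] (i : 'I_n) := chr_mpoly (row_mx (row i (tc_u (ZJ j))) (0 : 'rV[int]_d)).
pose coef i := eJ j i * (tc_c (ZJ j) i * mon (tc_u (ZJ j)) del i).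
pose Phi (k : 'I_N) : {mpoly algC[(r + d) + (r + d)]} := \sum_(i < n | lab i == k) coef i *: p i.
pose pr (t : point (r + d)) : point r := fun i => t (lshift d i).
have prT t : in_torus t -> in_torus (pr t) by move=> Tt i; apply: Tt.
have PhiE t : in_torus t -> (fun k => (Phi k).@[tt_inv t]) = psi (Z := ZJ) lab eJ (pmul del (pr t)).
  move=> Tt; apply: functional_extensionality => k.
  rewrite /Phi rmorph_sum /=; apply: eq_bigr => i _; rewrite mevalZ Hp //.
  rewrite /coef -!mulrA; congr (_ * _); rewrite /tc_pt /pmul -/(pmul del (pr t)) mon_pmul /pmul.
  congr (_ * (_ * _)); rewrite mon_row /chr /mon big_split_ord /=.
  rewrite [X in _ * X]big1 ?mulr1; last by move=> q _; rewrite row_mxEr mxE expr0z.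
  by apply: eq_bigr => q _; rewrite row_mxEl.
exists l', (r + d)%N, (block_mx A 0 0 0), Phi; split=> //.
- by rewrite leq_addl.
(* The equations of X hold on a dense set of parameters, where the image is in P, hence on the whole
   torus. *)
- move=> t Tt; rewrite PhiE // => q qI.
  have Lq : laurent (fun xi => q.@[psi (Z := ZJ) (j := j) lab eJ xi]).
    apply: (@laurent_meval _ _ q (fun xi => psi (Z := ZJ) lab eJ xi)) => k.
    exact: psi_laurent.
  apply: (dD j _ Lq) => [xi [_ Pxi _]|]; first exact: (PX _ Pxi q qI).
  by apply: pmul_torus => //; apply: prT.
- move=> q Hq; apply: gj => _ [xi [[uxi _ _] ->]].
  have Txi := torsion_torus uxi.
  (* Dividing by del undoes the translation, so every [psi xi] is reached. *)
  pose t : point (r + d) := fun i => match split i with inl i' => xi i' / del i' | inr _ => 1 end.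
  have Tt : in_torus t.
    move=> i; rewrite /t; case: split => i'; last exact: oner_neq0.
    by rewrite mulf_neq0 ?invr_eq0.
  have <- : (fun k => (Phi k).@[tt_inv t]) = psi (Z := ZJ) lab eJ xi.
    rewrite PhiE //; congr psi; apply: functional_extensionality => i.
    by rewrite /pmul /pr /t (unsplitK (inl i)) mulrC divfK.
  by apply: Hq; exists t.
- move=> t Tt k; rewrite PhiE // H; last exact: prT.
  have TA : in_torus (gm_endo (block_mx A 0 0 0) t) by apply: (mon_torus _ Tt).
  rewrite -[RHS]/((fun k => (Phi k).@[tt_inv (gm_endo (block_mx A 0 0 0) t)]) k) PhiE //.
  congr (psi _ _ (pmul _ _) k); apply: functional_extensionality => i.
  rewrite /pr /gm_endo /mon big_split_ord /= [X in _ = _ * X]big1 ?mulr1.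
    by apply: eq_bigr => q _; rewrite block_mxEul.
  by move=> q _; rewrite block_mxEur mxE expr0z.
Qed.
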